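(* Let $d\ge1$ be an integer, $T>0$ and $p\in[2,3)$. Let $\mathbf{X}=(X,\mathbb{X})\in\mathcal{D}^p([0,T];\mathbb{R}^d)$ be a càdlàg $p$-rough path, $L\in D^p([0,T];\mathbb{R})$ and $f\in C_b^3(\mathbb{R};\mathcal{L}(\mathbb{R}^d;\mathbb{R}))$. Then, for every $y\in\mathbb{R}$ with $y\ge L_0$, there exists at most one solution $(Y,Y',K)$ with $Y'=f(Y)$ to the one-dimensional reflected rough differential equation $$Y_t=y+\int_0^tf(Y_s)\,\mathrm{d}\mathbf{X}_s+K_t,\qquad t\in[0,T],$$ with reflecting lower barrier $L$.
   Context: Variation norms. For $r\ge1$ and a finite-dimensional normed space $E$, $D^r([0,T];E)$ is the space of càdlàg paths $Z:[0,T]\to E$ with $\|Z\|_{r,[0,T]}<\infty$, where $\|Z\|_{r,[s,t]}:=\big(\sup_{\mathcal{P}}\sum_{[u,v]\in\mathcal{P}}|Z_{u,v}|^r\big)^{1/r}$, $Z_{u,v}:=Z_v-Z_u$, the supremum being over finite partitions $\mathcal{P}$ of $[s,t]$. Let $\Delta_T:=\{(s,t)\in[0,T]^2:s\le t\}$. For two-parameter functions $\Xi:\Delta_T\to E$, $\|\Xi\|_{r,[s,t]}:=\big(\sup_{\mathcal{P}}\sum_{[u,v]\in\mathcal{P}}|\Xi_{u,v}|^r\big)^{1/r}$, and $D^{r}(\Delta_T;E)$ denotes those $\Xi$ with $\|\Xi\|_{r,[0,T]}<\infty$ such that $s\mapsto\Xi_{s,t}$ (fixed $t$) and $t\mapsto\Xi_{s,t}$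 (fixed $s$) are càdlàg. Function spaces. $\mathcal{L}(\mathbb{R}^d;\mathbb{R})$ is the space of linear maps $\mathbb{R}^d\to\mathbb{R}$; $C_b^k(\mathbb{R};\mathcal{L}(\mathbb{R}^d;\mathbb{R}))$ is the space of $k$-times differentiable functions which, with all derivatives up to order $k$, are continuous and bounded. Rough paths. For $p\in[2,3)$, $\mathbf{X}=(X,\mathbb{X})$ is a càdlàg $p$-rough path over $\mathbb{R}^d$ (written $\mathbf{X}\in\mathcal{D}^p([0,T];\mathbb{R}^d)$) if $X\in D^p([0,T];\mathbb{R}^d)$, $\mathbb{X}\in D^{p/2}(\Delta_T;\mathbb{R}^{d\times d})$ and $\mathbb{X}_{s,t}-\mathbb{X}_{s,u}-\mathbb{X}_{u,t}=X_{s,u}\otimes X_{u,t}$ for all $0\le s\le u\le t\le T$. Controlled paths. $(Y,Y')\in\mathcal{V}_X^p([0,T];E)$ (controlled path with respect to $X$) if $Y\in D^p([0,T];E)$, $Y'\in D^p([0,T];\mathcal{L}(\mathbb{R}^d;E))$ and $R^Y\in D^{p/2}(\Delta_T;E)$, where $R^Y_{s,t}:=Y_{s,t}-Y'_sX_{s,t}$. Rough integral. For $(H,H')\in\mathcal{V}_X^p([0,T];\mathcal{L}(\mathbb{R}^d;\mathbb{R}))$, $\int_s^tH_r\,\mathrm{d}\mathbf{X}_r:=\lim_{|\mathcal{P}|\to0}\sum_{[u,v]\in\mathcal{P}}\big(H_uX_{u,v}+H'_u\mathbb{X}_{u,v}\big)$ over partitions of $[s,t]$ with mesh tending to $0$,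 where $H'_u\in\mathcal{L}(\mathbb{R}^d;\mathcal{L}(\mathbb{R}^d;\mathbb{R}))$ is identified with a linear map $\mathbb{R}^{d\times d}\to\mathbb{R}$ (so that $x\otimes z\mapsto (H'_ux)z$); this limit exists. For $(Y,Y')\in\mathcal{V}_X^p([0,T];\mathbb{R})$ and $f\in C_b^3$, $\int f(Y)\,\mathrm{d}\mathbf{X}$ is the rough integral of the controlled path $(f(Y),\mathrm{D}f(Y)Y')$. Solution. $(Y,Y',K)$ is a solution to the reflected rough differential equation if $(Y,Y')\in\mathcal{V}_X^p([0,T];\mathbb{R})$ and $K\in D^1([0,T];\mathbb{R})$ satisfy the displayed equation and: (a) $Y_t\ge L_t$ for all $t\in[0,T]$; (b) $K:[0,T]\to\mathbb{R}$ is non-decreasing with $K_0=0$ and $\int_0^t(Y_s-L_s)\,\mathrm{d}K_s=0$ for all $t\in[0,T]$, this last integral being a Lebesgue–Stieltjes integral. *)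

(* Defs.v *)
From HB Require Import structures.
From mathcomp Require Import all_boot all_order all_algebra.
From mathcomp Require Import all_classical all_reals all_analysis.

Set Implicit Arguments.
Unset Strict Implicit.
Unset Printing Implicit Defensive.

Import Order.TTheory GRing.Theory Num.Theory.
Import numFieldNormedType.Exports.

Local Open Scope classical_set_scope.
Local Open Scope ring_scope.

(* A path on [0, T] is a total function on R of which only the values on
   [0, T] are ever used; likewise a two-parameter function on
   {(s, t) | 0 <= s <= t <= T} is a function R -> R -> E.

   Spaces:    R^d               'cV[R]_d,   x (x) z := x *m z^T in 'M[R]_d
              L(R^d; R)         'rV[R]_d,   acting by [linform]
              L(R^d; L(R^d; R)) 'M[R]_d,    A maps x to x^T *m A; see [bilform]
   Their norm is the library's (maximum) norm; the norms of a finite-dimensional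
   space being equivalent, this choice does not affect any notion below. *)

Section Partitions.
Context {R : realType}.

(* With P : itv_partition a b, zip (a :: P) P lists the subintervals (u, v);
   if a = b, the only partition is [::], which has no subinterval. *)
Definition psum {V : nmodType} (a : R) (P : seq R) (Xi : R -> R -> V) : V :=
  \sum_(uv <- zip (a :: P) P) Xi uv.1 uv.2.

Definition mesh (a : R) (P : seq R) : R :=
  \big[Num.max/0]_(uv <- zip (a :: P) P) (uv.2 - uv.1).

(* Filter on the partitions of [a, b] describing mesh -> 0. *)
Definition mesh_to0 (a b : R) : set_system (seq R) :=
  filter_from [set delta : R | 0 < delta]
    (fun delta => [set P | itv_partition a b P /\ mesh a P < delta]).

#[global] Instance mesh_to0_filter a b : Filter (mesh_to0 a b).
Proof.
apply: filter_from_filter; first by exists 1 => /=.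
move=> e1 e2 /= e1_gt0 e2_gt0; exists (Num.min e1 e2).
  by rewrite /= lt_min e1_gt0.
by move=> P [abP]; rewrite lt_min => /andP[m1 m2].
Qed.

End Partitions.

Section VariationNorms.
Context {R : realType} {E : normedModType R}.

Definition incr (Z : R -> E) (u v : R) : E := Z v - Z u.

Definition rvar (r a b : R) (Xi : R -> R -> E) : \bar R :=
  ((ereal_sup [set (psum a P (fun u v => `|Xi u v| `^ r))%:E
              | P in itv_partition a b]) `^ (r^-1))%E.

Definition cadlag (a b : R) (Z : R -> E) : Prop :=
  (forall t, a <= t < b -> Z s @[s --> t^'+] --> Z t) /\
  (forall t, a < t <= b -> cvg (Z s @[s --> t^'-])).

Definition Dpath (r T : R) (Z : R -> E) : Prop :=
  cadlag 0 T Z /\ (rvar r 0 T (incr Z) < +oo)%E.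

Definition Dpath2 (r T : R) (Xi : R -> R -> E) : Prop :=
  [/\ (rvar r 0 T Xi < +oo)%E,
      forall t, 0 <= t <= T -> cadlag 0 t (fun s => Xi s t) &
      forall s, 0 <= s <= T -> cadlag s T (fun t => Xi s t)].

End VariationNorms.

Definition Cb {R : realType} {E : normedModType R} (k : nat) (f : R -> E) :=
  (forall j, (j < k)%N -> forall x, derivable (derive1n j f) x 1) /\
  (forall j, (j <= k)%N ->
     continuous (derive1n j f) /\ exists M, forall x, `|derive1n j f x| <= M).

Section RoughPaths.
Context {R : realType} {d : nat}.

Definition rough_path (p T : R) (X : R -> 'cV[R]_d) (XX : R -> R -> 'M[R]_d) :=
  [/\ Dpath p T X,
      Dpath2 (p / 2) T XX &
      forall s u t, 0 <= s -> s <= u -> u <= t -> t <= T ->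
        XX s t - XX s u - XX u t = incr X s u *m (incr X u t)^T].

Definition linform (a : 'rV[R]_d) (x : 'cV[R]_d) : R := (a *m x) 0 0.

Definition bilform (A M : 'M[R]_d) : R := \tr (A^T *m M).

Lemma bilform_tensor (A : 'M[R]_d) (x z : 'cV[R]_d) :
  bilform A (x *m z^T) = linform (x^T *m A) z.
Proof.
rewrite /bilform /linform mulmxA mxtrace_mulC -[RHS]trace_mx11.
by rewrite -mxtrace_tr !trmx_mul !trmxK.
Qed.

Definition controlled (p T : R) (X : R -> 'cV[R]_d)
    (Y : R -> R) (Y' : R -> 'rV[R]_d) : Prop :=
  [/\ Dpath p T Y,
      Dpath p T Y' &
      Dpath2 (p / 2) T (fun s t => incr Y s t - linform (Y' s) (incr X s t))].

Definition is_rough_integral (X : R -> 'cV[R]_d) (XX : R -> R -> 'M[R]_d)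
    (H : R -> 'rV[R]_d) (H' : R -> 'M[R]_d) (s t I : R) : Prop :=
  psum s P (fun u v => linform (H u) (incr X u v) + bilform (H' u) (XX u v))
    @[P --> mesh_to0 s t] --> I.

(* The composition Df(Y) Y' of Y' in L(R^d; R) with b = Df(Y) in
   L(R; L(R^d; R)), the latter space being identified with L(R^d; R). *)
Definition compform (b a : 'rV[R]_d) : 'M[R]_d := a^T *m b.

Lemma compformE (b a : 'rV[R]_d) (x : 'cV[R]_d) :
  x^T *m compform b a = linform a x *: b.
Proof.
rewrite /compform /linform mulmxA -trmx_mul.
by rewrite [a *m x]mx11_scalar tr_scalar_mx mul_scalar_mx [in RHS]mxE mulr1n.
Qed.

End RoughPaths.

Section Reflected.
Context {R : realType}.

(* The extension of K from [0, T] to R which is constant outside [0, T]; its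
   Stieltjes measure has no mass outside ]0, T] if K is right-continuous. *)
Definition const_ext (T : R) (K : R -> R) (s : R) : R :=
  K (Num.min (Num.max s 0) T).

(* The function F required in [reflected_solution] always exists. *)
Lemma const_ext_cumulative (T : R) (K : R -> R) : 0 < T ->
  cadlag 0 T K ->
  (forall s t, 0 <= s -> s <= t -> t <= T -> K s <= K t) ->
  exists F : cumulative R R, F =1 const_ext T K.
Proof.
move=> T0 [rcK _] ndK.
have nd : nondecreasing (const_ext T K).
  move=> s t st; apply: ndK.
  - by rewrite le_min le_max lexx orbT ltW.
  - by rewrite le_min !ge_min ge_max !le_max st !lexx !orbT.
  - by rewrite ge_min lexx orbT.
have rc : right_continuous (const_ext T K).
  move=> x; have [x0|x0] := ltP x 0.
    apply: cvg_near_cst; near=> s; rewrite /const_ext.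
    have s0 : s < 0 by near: s; exact: nbhs_right_lt.
    by rewrite !max_r// ltW.
  have [xT|xT] := ltP x T.
    have -> : const_ext T K x = K x by rewrite /const_ext max_l// min_l// ltW.
    apply: cvg_trans (rcK x _); last by rewrite x0.
    apply: near_eq_cvg; near=> s; rewrite /const_ext.
    have xs : x < s by near: s; exact: nbhs_right_gt.
    have sT : s < T by near: s; exact: nbhs_right_lt.
    by rewrite max_l ?min_l// ltW// (le_lt_trans x0).
  apply: cvg_near_cst; near=> s; rewrite /const_ext.
  have xs : x < s by near: s; exact: nbhs_right_gt.
  rewrite [Num.max x 0]max_l// max_l; last exact/ltW/(le_lt_trans x0).
  by rewrite !min_r// (le_trans xT)// ltW.
pose m := isCumulative.Build R _ R (const_ext T K) nd rc.
by exists (HB.pack_for (cumulative R R) (const_ext T K) m).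
Unshelve. all: by end_near. Qed.

Definition reflected_solution {d : nat} (p T : R)
    (X : R -> 'cV[R]_d) (XX : R -> R -> 'M[R]_d)
    (L : R -> R) (f : R -> 'rV[R]_d) (y : R)
    (Y : R -> R) (Y' : R -> 'rV[R]_d) (K : R -> R) : Prop :=
  [/\ controlled p T X Y Y' /\ Dpath 1 T K,
      forall t, 0 <= t <= T ->
        exists2 I : R,
          is_rough_integral X XX (fun s => f (Y s))
            (fun s => compform (derive1 f (Y s)) (Y' s)) 0 t I &
          Y t = y + I + K t,
      forall t, 0 <= t <= T -> L t <= Y t,
      (forall s t, 0 <= s -> s <= t -> t <= T -> K s <= K t) /\ K 0 = 0 &
      exists2 F : cumulative R R, F =1 const_ext T K &
        forall t, 0 <= t <= T ->
          (\int[lebesgue_stieltjes_measure F]_(s in `]0%R, t])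
             (Y s - L s)%R%:E = 0)%E].

End Reflected.

(* Main.v *)
Require Import Defs.
From mathcomp Require Import all_boot all_order all_algebra.
From mathcomp Require Import all_classical all_reals all_analysis.
From mathcomp Require Import ring lra.
Set Implicit Arguments.
Unset Strict Implicit.
Unset Printing Implicit Defensive.
Import Order.TTheory GRing.Theory Num.Theory.
Import numFieldNormedType.Exports.
Local Open Scope classical_set_scope.
Local Open Scope ring_scope.

(** The argument follows the difference Z = Y1 - Y2 just after the infimum tau
    of the times at which Z is not zero. It rests on the order of the line:
    wherever Y1 > Y2, the path Y1 is strictly above the barrier, so that K1 is
    constant there ([stieltjes_flat]).

    Z also vanishes at tau. Indeed the rough integral moves from s to t by the
    germ f(Y_s) X_(s,t) + Df(Y_s)f(Y_s) XX_(s,t), up to an error which tends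
    to 0 as s increases to t ([germ_jump]); for two solutions that agree before
    t these germs are equal, and if Z_t > 0 then K1 does not jump at t, while
    the jump of K2 can only lower Z ([agreement_extends]).

    By right-continuity the p- and p/2-variations of the driver and of both
    solutions are small on some [tau, beta] with beta > tau ([pvar_right0]). The difference of the
    germs from s to t is then at most |Z_s| / 2, which prevents Z from jumping
    from a nonpositive to a positive value ([no_upward_crossing]). So if
    Z_t > 0 for some t in [tau, beta], there is a in [tau, t[ such that
    Z_a = 0 and Z > 0 on ]a, t]; on [a, t] the term K1 is constant and
        Z_v - Z_u = int_u^v (f(Y1) - f(Y2)) dX - (K2_v - K2_u).
    The decisive point is that this also bounds the variation of K2, which
    nothing else relates to Z: K2 is nondecreasing, the germ vanishes at a
    and Z_t >= 0, hence K2_t - K2_a is at most the error made when the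
    integral over [a, t] is replaced by its germ. That error is estimated by
    sewing ([sewing], [germ_diff_defect]) in terms of the p/2-variation norm N
    of the remainder Z_(u,v) - (f(Y1_u) - f(Y2_u)) X_(u,v), which dominates
    sup |Z| because Z_a = 0. All in all N ^ (p / 2) <= 12 (C kappa N) ^ (p / 2),
    where kappa measures the size of the data on [tau, beta]; for a small
    kappa this forces N = 0, so Z = 0 on [a, t], a contradiction ([excursion_vanishes],
    [local_comparison]).

    Exchanging the two solutions gives Z = 0 on [tau, beta], against the
    choice of tau ([solutions_agree]). Equal paths have equal integrals, and
    then K1 = K2 by the equation. *)

(** * Sums over partitions *)

Section PartitionSums.
Context {R : realType}.
Implicit Types (a b u v m : R) (P Q : seq R).

Lemma psum_nil {V : nmodType} a (Xi : R -> R -> V) : psum a [::] Xi = 0.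
Proof. by rewrite /psum big_nil. Qed.

Lemma psum_cons {V : nmodType} a x P (Xi : R -> R -> V) :
  psum a (x :: P) Xi = Xi a x + psum x P Xi.
Proof. by rewrite /psum big_cons. Qed.

Lemma psum_cat {V : nmodType} a P Q (Xi : R -> R -> V) :
  psum a (P ++ Q) Xi = psum a P Xi + psum (last a P) Q Xi.
Proof.
elim: P a => [|x P IH] a /=; first by rewrite psum_nil add0r.
by rewrite !psum_cons IH addrA.
Qed.

Lemma itv_partition_consE a b x P :
  itv_partition a b (x :: P) <-> a < x /\ itv_partition x b P.
Proof.
rewrite /itv_partition /=; split.
  by move=> [/andP[-> ->] ->].
by move=> [-> [-> ->]].
Qed.

Lemma itv_partition_cat_inv a b P Q : itv_partition a b (P ++ Q) ->
  itv_partition a (last a P) P /\ itv_partition (last a P) b Q.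
Proof.
rewrite /itv_partition cat_path last_cat => -[/andP[pP pQ] lQ].
by rewrite eqxx.
Qed.

Lemma ler_psum a b P (F G : R -> R -> R) : itv_partition a b P ->
  (forall u v, a <= u -> u < v -> v <= b -> F u v <= G u v) ->
  psum a P F <= psum a P G.
Proof.
elim: P a => [|x P IH] a; first by rewrite !psum_nil.
move=> /itv_partition_consE[ax xbP] FG; have xb := itv_partition_le xbP.
rewrite !psum_cons lerD ?FG//; apply: IH => // u v xu.
by apply: FG; rewrite (le_trans (ltW ax)).
Qed.

Lemma eq_psum {V : nmodType} a b P (F G : R -> R -> V) : itv_partition a b P ->
  (forall u v, a <= u -> u < v -> v <= b -> F u v = G u v) ->
  psum a P F = psum a P G.
Proof.
elim: P a => [|x P IH] a; first by rewrite !psum_nil.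
move=> /itv_partition_consE[ax xbP] FG; have xb := itv_partition_le xbP.
rewrite !psum_cons FG//; congr (_ + _); apply: IH => // u v xu.
by apply: FG; rewrite (le_trans (ltW ax)).
Qed.

Lemma psumD a P (F G : R -> R -> R) :
  psum a P (fun u v => F u v + G u v) = psum a P F + psum a P G.
Proof. by rewrite /psum big_split. Qed.

Lemma psumB a P (F G : R -> R -> R) :
  psum a P (fun u v => F u v - G u v) = psum a P F - psum a P G.
Proof. by rewrite /psum sumrB. Qed.

Lemma psumZ a P k (F : R -> R -> R) :
  psum a P (fun u v => k * F u v) = k * psum a P F.
Proof. by rewrite /psum mulr_sumr. Qed.

Lemma mesh_cons a x P : mesh a (x :: P) = Num.max (x - a) (mesh x P).
Proof. by rewrite /mesh big_cons. Qed.

Lemma mesh_cat a P Q : mesh a (P ++ Q) = Num.max (mesh a P) (mesh (last a P) Q).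
Proof.
elim: P a => [|x P IH] a /=; last by rewrite !mesh_cons IH maxA.
rewrite {2}/mesh big_nil max_r//.
by elim: Q a => [|x Q IH] a; rewrite ?mesh_cons ?le_max ?IH ?orbT// /mesh big_nil.
Qed.

Lemma ex_fine_partition a b (e : R) : a <= b -> 0 < e ->
  exists2 P, itv_partition a b P & mesh a P < e.
Proof.
move=> ab e0; pose h := e / 2; have h0 : 0 < h by rewrite divr_gt0.
have he : h < e by rewrite /h; lra.
have [n] : exists n, b - a <= n%:R * h.
  exists (Num.bound ((b - a) / h)); rewrite -ler_pdivrMr//.
  by apply/ltW/archi_boundP; rewrite divr_ge0 ?subr_ge0// ltW.
elim: n a ab => [|n IH] a ab nb.
  exists [::]; last by rewrite /mesh big_nil.
  by split=> //=; rewrite eq_le ab/= -subr_le0 (le_trans nb)// mul0r.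
have [bh|bh] := leP (b - a) h.
  move: ab; rewrite le_eqVlt => /predU1P[->|ab].
    by exists [::]; [split=> /= | rewrite /mesh big_nil].
  exists [:: b]; first exact: itv_partition1.
  by rewrite mesh_cons /mesh big_nil gt_max e0 (le_lt_trans bh).
have [||P P1 P2] := IH (a + h); first lra.
  by move: nb; rewrite -natr1 mulrDl mul1r; lra.
exists (a + h :: P); last by rewrite mesh_cons gt_max P2 andbT; lra.
by apply/itv_partition_consE; split=> //; lra.
Qed.

End PartitionSums.

(** * Controls and the sewing estimate *)

Section Controls.
Context {R : realType}.
Implicit Types (a b u v m : R) (P Q : seq R) (w : R -> R -> R).

(** Superadditivity without continuity: the variation of a path with jumps is
    not continuous. *)
Definition control a b w : Prop :=
  (forall u v, a <= u -> u <= v -> v <= b -> 0 <= w u v) /\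
  (forall u m v, a <= u -> u <= m -> m <= v -> v <= b ->
     w u m + w m v <= w u v).

Lemma control_diag a b w u : control a b w -> a <= u -> u <= b -> w u u = 0.
Proof.
move=> [w0 wD] au ub; apply/eqP; rewrite eq_le w0// andbT.
by have := wD u u u au (lexx _) (lexx _) ub; lra.
Qed.

Lemma control_le a b w u v u' v' : control a b w ->
  a <= u -> u <= u' -> u' <= v' -> v' <= v -> v <= b -> w u' v' <= w u v.
Proof.
move=> [w0 wD] au uu' uv' vv' vb.
have av' : a <= u' by lra.
have h1 := w0 u u' au uu'.
have h2 := w0 v' v (le_trans av' uv') vv' vb.
have h3 := wD u v' v au (le_trans uu' uv') vv' vb.
have h4 := wD u u' v' au uu' uv'; lra.
Qed.

Lemma control_sub a b a' b' w : a <= a' -> b' <= b ->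
  control a b w -> control a' b' w.
Proof.
move=> aa' bb' [w0 wD]; split.
  by move=> u v au uv vb; apply: w0 => //; lra.
by move=> u m v au um mv vb; apply: wD => //; lra.
Qed.

Lemma controlD a b w1 w2 : control a b w1 -> control a b w2 ->
  control a b (fun u v => w1 u v + w2 u v).
Proof.
move=> [w0 wD] [z0 zD]; split.
  by move=> u v au uv vb; rewrite addr_ge0 ?w0 ?z0.
move=> u m v au um mv vb.
by have := wD _ _ _ au um mv vb; have := zD _ _ _ au um mv vb; lra.
Qed.

Lemma controlZ a b w k : 0 <= k -> control a b w ->
  control a b (fun u v => k * w u v).
Proof.
move=> k0 [w0 wD]; split.
  by move=> u v au uv vb; rewrite mulr_ge0 ?w0.
by move=> u m v au um mv vb; rewrite -mulrDr ler_wpM2l ?wD.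
Qed.

Lemma psum_control a b w u v P : control a b w -> a <= u -> v <= b ->
  itv_partition u v P -> psum u P w <= w u v.
Proof.
move=> cw; elim: P u => [|x P IH] u au vb.
  move=> /[dup] /itv_partition_le uv _.
  by rewrite psum_nil cw.1.
move=> /itv_partition_consE[ux xP]; have xv := itv_partition_le xP.
rewrite psum_cons; apply: le_trans (cw.2 u x v au (ltW ux) xv vb).
by rewrite lerD2l IH// (le_trans au)// ltW.
Qed.

(** The last subinterval whose left part still has mass at most h: what lies
    strictly before it is light, and what lies after it is light too once
    h is half of the total mass, by superadditivity. *)
Lemma control_split a b w u v h P : control a b w -> a <= u -> v <= b ->
  0 <= h -> itv_partition u v P -> P != [::] ->
  exists P1 q P2, [/\ P = P1 ++ q :: P2, w u (last u P1) <= h &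
    P2 = [::] \/ h < w u q].
Proof.
move=> cw au vb h0 uvP PN.
have uv := itv_partition_le uvP.
have : w u u <= h by rewrite (control_diag cw)// (le_trans uv).
elim: P {1 3 5}u uvP PN => // q P IH x /itv_partition_consE[xq qP] _ wx.
have [->|PN] := eqVneq P [::].
  by exists [::], q, [::]; split=> //; left.
have [wq|wq] := leP (w u q) h; last first.
  by exists [::], q, P; split=> //; right.
have [P1 [q' [P2 [-> h1 h2]]]] := IH q qP PN wq.
by exists (q :: P1), q', P2; split.
Qed.

(** The fixed point of A = 2 + 2 * A * (1 / 2) ^ theta, the recursion met when
    an interval is cut into two halves of equal mass. *)
Definition sewing_const (theta : R) : R := 2 / (1 - 2 `^ (1 - theta)).

Lemma sewing_const_ge0 theta : 1 < theta -> 0 <= sewing_const theta.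
Proof.
move=> t1; rewrite divr_ge0// subr_ge0 -[leRHS](powRr0 (2 : R)).
by rewrite ler_powR ?ler1n//; lra.
Qed.

(** Cut the partition at a subinterval ]l, q] such that w u l and w q v are at
    most half of w u v. Passing from Xi u v to Xi u l + Xi l q + Xi q v costs
    two defects, and by induction on the number of points the two halves cost
    2 * (1 / 2) ^ theta times the bound claimed for the whole. *)
Lemma sewing a b w (theta c : R) (Xi : R -> R -> R) :
  1 < theta -> 0 <= c -> control a b w ->
  (forall u, a <= u -> u <= b -> Xi u u = 0) ->
  (forall u m v, a <= u -> u <= m -> m <= v -> v <= b ->
     `|Xi u v - Xi u m - Xi m v| <= c * w u v `^ theta) ->
  forall u v P, a <= u -> v <= b -> itv_partition u v P ->
    `|psum u P Xi - Xi u v| <= sewing_const theta * c * w u v `^ theta.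
Proof.
move=> t1 c0 cw Xi0 dXi u v P; have [n] := ubnP (size P).
elim: n P u v => // n IH P u v szP au vb uvP.
have A0 := sewing_const_ge0 t1.
have uv := itv_partition_le uvP.
have [P0|PN] := eqVneq P [::].
  move: uvP; rewrite P0 => /itv_partition_nil uvE.
  rewrite psum_nil -uvE Xi0 ?(le_trans uv)// subrr normr0.
  apply: mulr_ge0 (powR_ge0 _ _); exact: mulr_ge0.
have wuv0 : 0 <= w u v by apply: cw.1.
have h0 : 0 <= w u v / 2 by rewrite divr_ge0.
have [P1 [q [P2 [PE wl wr]]]] := control_split cw au vb h0 uvP PN.
move: uvP szP; rewrite PE => /itv_partition_cat_inv[+ /itv_partition_consE].
set l := last u P1 => uP1 [lq qP2]; rewrite size_cat /= => szP.
have ul := itv_partition_le uP1; have qv := itv_partition_le qP2.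
have wr' : w q v <= w u v / 2.
  case: wr => [P20|wr].
    move: qP2; rewrite P20 => /itv_partition_nil ->.
    by rewrite (control_diag cw)// (le_trans au).
  have := cw.2 u q v au (le_trans ul (ltW lq)) qv vb; lra.
have sz1 : (size P1 < n)%N.
  by move: szP; rewrite ltnS; apply: leq_trans; rewrite addnS ltnS leq_addr.
have sz2 : (size P2 < n)%N.
  by move: szP; rewrite ltnS; apply: leq_trans; rewrite addnS ltnS leq_addl.
have lb : l <= b by lra.
have aq : a <= q by lra.
have := IH P1 u l sz1 au lb uP1; have := IH P2 q v sz2 aq vb qP2.
rewrite -/l in wl.
have d1 := dXi u l v au ul ltac:(lra) vb.
have d2 := dXi l q v ltac:(lra) ltac:(lra) qv vb.
have pm x y : 0 <= x -> x <= y -> x `^ theta <= y `^ theta.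
  by move=> x0 xy; rewrite ge0_ler_powR ?nnegrE//; lra.
have e2 : w l v `^ theta <= w u v `^ theta.
  by apply: pm; [apply: cw.1; lra|apply: (control_le cw); lra].
have e3 : w u l `^ theta <= (w u v / 2) `^ theta.
  by apply: pm wl; apply: cw.1; lra.
have e4 : w q v `^ theta <= (w u v / 2) `^ theta.
  by apply: pm wr'; apply: cw.1; lra.
have := powRM theta wuv0 (ltac:(lra) : 0 <= (2 : R)^-1).
move=> e5; rewrite {}e5 in e3 e4.
set A := sewing_const theta in A0 *.
set S := w u v `^ theta in d1 e2 e3 e4 *.
have S0 : 0 <= S by exact: powR_ge0.
have AE : A = 2 + 2 * A * (2^-1 `^ theta).
  have t2 : 2 * (2^-1 `^ theta) = 2 `^ (1 - theta) :> R.
    rewrite -[X in X * _ = _]powRr1// -powR_inv1// -powRrM.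
    by rewrite -powRD ?mulN1r// pnatr_eq0 implybT.
  have t3 : 2 `^ (1 - theta) < 1 :> R.
    by rewrite /powR pnatr_eq0/= expR_lt1 pmulr_llt0 ?ln_gt0 ?ltr1n//; lra.
  rewrite -mulrA [A * _]mulrC mulrA t2 /A /sewing_const; field.
  by apply/eqP; lra.
rewrite psum_cat psum_cons -/l.
set x1 := psum u P1 Xi; set x2 := psum q P2 Xi => i2 i1.
have -> : x1 + (Xi l q + x2) - Xi u v =
  (x1 - Xi u l) + (x2 - Xi q v) - (Xi u v - Xi u l - Xi l v)
   - (Xi l v - Xi l q - Xi q v) by ring.
have AC0 : 0 <= A * c by rewrite mulr_ge0.
have j1 := ler_wpM2l AC0 e3; have j2 := ler_wpM2l AC0 e4.
have j3 := ler_wpM2l c0 e2.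
have -> : A * c * S = c * S + c * S + (A * c * (S * 2^-1 `^ theta))
   + (A * c * (S * 2^-1 `^ theta)) by rewrite {1}AE; ring.
set d1' := Xi u v - _ - _ in d1 *; set d2' := Xi l v - _ - _ in d2 *.
have n1 := ler_normB (x1 - Xi u l + (x2 - Xi q v) - d1') d2'.
have n2 := ler_normB (x1 - Xi u l + (x2 - Xi q v)) d1'.
have n3 := ler_normD (x1 - Xi u l) (x2 - Xi q v).
lra.
Qed.

End Controls.

(** * Real powers *)

Section Powers.
Context {R : realType}.

Lemma powRK (x r : R) : 0 <= x -> 0 < r -> (x `^ r^-1) `^ r = x.
Proof. by move=> x0 r0; rewrite -powRrM mulVf ?gt_eqF// powRr1. Qed.

Lemma powR_add_le (x y r : R) : 0 <= x -> 0 <= y -> 0 <= r ->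
  (x + y) `^ r <= 2 `^ r * (x `^ r + y `^ r).
Proof.
move=> x0 y0 r0; wlog xy : x y x0 y0 / x <= y.
  move=> H; have [/H|/ltW /H] := leP x y; first exact.
  by rewrite addrC [_ `^ r + _]addrC; apply.
have h : (x + y) `^ r <= (2 * y) `^ r.
  by rewrite ge0_ler_powR ?nnegrE ?addr_ge0 ?mulr_ge0//; lra.
rewrite (le_trans h)// powRM// ler_wpM2l ?powR_ge0//.
by rewrite lerDr powR_ge0.
Qed.

Lemma powR_root_le (x k w r : R) : 0 < r -> 0 <= x -> 0 <= k -> 0 <= w ->
  x `^ r <= k `^ r * w -> x <= k * w `^ r^-1.
Proof.
move=> r0 x0 k0 w0 xkw.
have rK y : 0 <= y -> (y `^ r) `^ r^-1 = y.
  by move=> y0; rewrite -powRrM mulfV ?gt_eqF// powRr1.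
rewrite -[leLHS](rK x)// -[X in _ <= X * _](rK k)// -powRM ?powR_ge0//.
by rewrite ge0_ler_powR ?nnegrE ?invr_ge0 ?mulr_ge0 ?powR_ge0// ltW.
Qed.

End Powers.

(** * Power variation as a control *)

Section PowerVariation.
Context {R : realType} {E : normedModType R}.
Implicit Types (a b u v m r : R) (P Q : seq R) (Xi : R -> R -> E).

Definition finvar r a b Xi : Prop :=
  exists B, forall P, itv_partition a b P ->
    psum a P (fun u v => `|Xi u v| `^ r) <= B.

Definition pvar r Xi u v : R :=
  sup [set psum u P (fun s t => `|Xi s t| `^ r) | P in itv_partition u v].

Lemma rvar_finvar r a b Xi : 0 < r -> (rvar r a b Xi < +oo)%E ->
  finvar r a b Xi.
Proof.
move=> r0; rewrite /rvar.
set S := [set _ | _ in _]; case SE: (ereal_sup S) => [B| |].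
- move=> _; exists B => P abP; rewrite -lee_fin -SE.
  by apply: ereal_sup_ubound; exists P.
- by rewrite poweRyr ?invr_eq0 ?gt_eqF// ltxx.
- move=> _; exists 0 => P abP; rewrite -lee_fin.
  have : ((psum a P (fun u v => `|Xi u v| `^ r))%:E <= ereal_sup S)%E.
    by apply: ereal_sup_ubound; exists P.
  by rewrite SE leeNy_eq.
Qed.

Lemma ex_partition u v : u <= v -> exists P, itv_partition u v P.
Proof. by move=> uv; have [P] := ex_fine_partition uv ltr01; exists P. Qed.

Lemma psum_powR_ge0 r Xi u P : 0 <= psum u P (fun s t => `|Xi s t| `^ r).
Proof. by apply: sumr_ge0 => uv _; exact: powR_ge0. Qed.

Lemma finvar_sub r a b u v Xi : a <= u -> u <= v -> v <= b ->
  finvar r a b Xi -> finvar r u v Xi.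
Proof.
move=> au uv vb [B aB]; exists B => P uvP.
have [P1 aP1] := ex_partition au; have [P2 bP2] := ex_partition vb.
have := aB _ (itv_partition_cat aP1 (itv_partition_cat uvP bP2)).
apply: le_trans; rewrite 2!psum_cat.
have -> : last a P1 = u by case: aP1 => _ /eqP.
by have := psum_powR_ge0 r Xi a P1; have := psum_powR_ge0 r Xi (last u P) P2; lra.
Qed.

Lemma finvar_has_sup r u v Xi : u <= v -> finvar r u v Xi ->
  has_sup [set psum u P (fun s t => `|Xi s t| `^ r) | P in itv_partition u v].
Proof.
move=> uv [B uvB]; split.
  by have [P uvP] := ex_partition uv; exists (psum u P (fun s t => `|Xi s t| `^ r)), P.
by exists B => _ [P uvP <-]; exact: uvB.
Qed.

Lemma psum_le_pvar r u v Xi P : finvar r u v Xi -> itv_partition u v P ->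
  psum u P (fun s t => `|Xi s t| `^ r) <= pvar r Xi u v.
Proof.
move=> fv uvP; apply: ub_le_sup; last by exists P.
by have [] := finvar_has_sup (itv_partition_le uvP) fv.
Qed.

Lemma le_pvar r a b u v Xi : 0 < r -> finvar r a b Xi ->
  (forall s, a <= s -> s <= b -> Xi s s = 0) ->
  a <= u -> u <= v -> v <= b -> `|Xi u v| `^ r <= pvar r Xi u v.
Proof.
move=> r0 fv X0 au uv vb; have fuv := finvar_sub au uv vb fv.
move: (uv); rewrite le_eqVlt => /predU1P[uvE|ltuv].
  have uu : itv_partition u v [::] by split=> //=; rewrite uvE.
  have := psum_le_pvar fuv uu; rewrite psum_nil -uvE X0 ?(le_trans uv)//.
  by rewrite normr0 powR0 ?gt_eqF.
have := psum_le_pvar fuv (itv_partition1 ltuv).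
by rewrite psum_cons psum_nil addr0.
Qed.

(** Superadditivity: near-optimal partitions of [u, m] and [m, v] concatenate
    to a partition of [u, v]. *)
Lemma pvar_control r a b Xi : finvar r a b Xi -> control a b (pvar r Xi).
Proof.
move=> fv; split.
  move=> u v au uv vb; have fuv := finvar_sub au uv vb fv.
  have [P uvP] := ex_partition uv.
  by apply: le_trans (psum_le_pvar fuv uvP); exact: psum_powR_ge0.
move=> u m v au um mv vb.
have fum := finvar_sub au um (le_trans mv vb) fv.
have fmv := finvar_sub (le_trans au um) mv vb fv.
have fuv := finvar_sub au (le_trans um mv) vb fv.
apply/ler_addgt0Pr => e e0; have e2 : 0 < e / 2 by rewrite divr_gt0.
have [_ [P umP <-] Pe] := sup_adherent e2 (finvar_has_sup um fum).
have [_ [Q mvQ <-] Qe] := sup_adherent e2 (finvar_has_sup mv fmv).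
have := psum_le_pvar fuv (itv_partition_cat umP mvQ); rewrite psum_cat.
have -> : last u P = m by case: umP => _ /eqP.
move: Pe Qe; rewrite -/(pvar _ _ _ _) -/(pvar r Xi m v); lra.
Qed.

(** Take a near-optimal partition of [t, c] with first point x, where c is so
    close to t that the first term is at most e / 3. The other terms are at
    most the variation on [x, c], so superadditivity leaves at most 2 * e / 3
    for the variation on [t, x]. *)
Lemma pvar_right0 r t b Xi (e : R) : 0 < r -> t < b -> finvar r t b Xi ->
  Xi t v @[v --> t^'+] --> (0 : E) -> 0 < e ->
  exists2 c, t < c <= b & pvar r Xi t c <= e.
Proof.
move=> r0 tb fv Xi0 e0; have e3 : 0 < e / 3 by rewrite divr_gt0.
have [d d0 dX] : exists2 d, 0 < d & forall v, t < v -> v < t + d ->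
    `|Xi t v| `^ r <= e / 3.
  have k0 : 0 < (e / 3) `^ r^-1 by exact: powR_gt0.
  move/cvgrPdist_le : Xi0 => /(_ _ k0)[d /= d0 dX]; exists d => // v tv vd.
  rewrite -[leRHS](powRK (ltW e3) r0) ge0_ler_powR ?nnegrE ?powR_ge0 ?(ltW r0)//.
  have := dX v; rewrite sub0r normrN /=; apply=> //.
  by rewrite /ball_/= distrC gtr0_norm ?subr_gt0// ltrBlDl.
pose c := Num.min (t + d / 2) b.
have tc : t < c by rewrite /c lt_min tb andbT; lra.
have cb : c <= b by rewrite /c ge_min lexx orbT.
have cd : c < t + d by rewrite /c gt_min; apply/orP; left; lra.
have fc := finvar_sub (lexx _) (ltW tc) cb fv.
have wc := pvar_control fc.
have [_ [P tcP <-] Pe] := sup_adherent e3 (finvar_has_sup (ltW tc) fc).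
case: P tcP Pe => [/itv_partition_nil tcE|x P].
  by move: tc; rewrite tcE ltxx.
move=> /itv_partition_consE[tx xcP]; have xc := itv_partition_le xcP.
rewrite psum_cons -/(pvar _ _ _ _) => Pe.
have fx := finvar_sub (ltW tx) xc (lexx _) fc.
have h1 := psum_le_pvar fx xcP.
have h2 := wc.2 t x c (lexx _) (ltW tx) xc (lexx _).
have h3 := dX x tx (le_lt_trans xc cd).
by exists x; [rewrite tx (le_trans xc)|lra].
Qed.

Lemma finvarB r a b Xi1 Xi2 : 0 < r -> finvar r a b Xi1 -> finvar r a b Xi2 ->
  finvar r a b (fun u v => Xi1 u v - Xi2 u v).
Proof.
move=> r0 [B1 H1] [B2 H2]; exists (2 `^ r * (B1 + B2)) => P abP.
apply: (@le_trans _ _ (psum a P (fun u v =>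
    2 `^ r * (`|Xi1 u v| `^ r + `|Xi2 u v| `^ r)))).
  apply: ler_psum abP _ => u v _ _ _.
  apply: le_trans (powR_add_le _ _ (ltW r0)) => //.
  by rewrite ge0_ler_powR ?nnegrE ?addr_ge0 ?ler_normB// ltW.
by rewrite psumZ psumD ler_wpM2l ?powR_ge0// lerD ?H1 ?H2.
Qed.

End PowerVariation.

(** * Integrals as limits of sums over fine partitions *)

Section GermIntegral.
Context {R : realType}.
Implicit Types (Xi : R -> R -> R) (J : R -> R).

Lemma germ_cvgE Xi s t (I e : R) :
  psum s P Xi @[P --> mesh_to0 s t] --> I -> 0 < e ->
  exists2 d, 0 < d & forall P, itv_partition s t P -> mesh s P < d ->
    `|I - psum s P Xi| <= e.
Proof.
move/cvgrPdist_le => H e0; have [d /= d0 dP] := H _ e0.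
by exists d => // P stP Pd; apply: dP.
Qed.

Lemma eq_germ_cvg Xi Xi' s t (I : R) :
  (forall u v, s <= u -> u < v -> v <= t -> Xi u v = Xi' u v) ->
  psum s P Xi @[P --> mesh_to0 s t] --> I ->
  psum s P Xi' @[P --> mesh_to0 s t] --> I.
Proof.
move=> XiE; apply: cvg_trans; apply: near_eq_cvg; exists 1 => //= P [stP _].
exact: eq_psum stP XiE.
Qed.

Lemma germ_unique Xi s t (I1 I2 : R) : s <= t ->
  psum s P Xi @[P --> mesh_to0 s t] --> I1 ->
  psum s P Xi @[P --> mesh_to0 s t] --> I2 -> I1 = I2.
Proof.
move=> st H1 H2; apply/eqP; rewrite -subr_eq0 -normr_le0.
apply/ler_addgt0Pr => e e0; have e2 : 0 < e / 2 by rewrite divr_gt0.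
have [d1 d10 h1] := germ_cvgE H1 e2; have [d2 d20 h2] := germ_cvgE H2 e2.
have d0 : 0 < Num.min d1 d2 by rewrite lt_min d10.
have [P stP] := ex_fine_partition st d0.
rewrite lt_min => /andP[/(h1 _ stP) k1 /(h2 _ stP) k2].
have -> : I1 - I2 = (I1 - psum s P Xi) - (I2 - psum s P Xi) by ring.
by apply: le_trans (ler_normB _ _) _; lra.
Qed.

(** The threshold d does not depend on s: a partition of [s, t] is prolonged
    by a partition of [0, s] as fine as the convergence at time s requires. *)
Lemma germ_approx T Xi J :
  (forall t, 0 <= t <= T -> psum 0 P Xi @[P --> mesh_to0 0 t] --> J t) ->
  forall t e, 0 <= t <= T -> 0 < e ->
  exists2 d, 0 < d & forall s Q, 0 <= s -> itv_partition s t Q ->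
    mesh s Q < d -> `|J t - J s - psum s Q Xi| <= e.
Proof.
move=> HJ t e /andP[t0 tT] e0; have e2 : 0 < e / 2 by rewrite divr_gt0.
have [d d0 dt] := germ_cvgE (HJ t (ltac:(rewrite t0 tT//))) e2.
exists d => // s Q s0 stQ Qd; have st := itv_partition_le stQ.
have sT : 0 <= s <= T by rewrite s0 (le_trans st).
have [d' d'0 ds] := germ_cvgE (HJ s sT) e2.
have dd0 : 0 < Num.min d d' by rewrite lt_min d0.
have [P sP] := ex_fine_partition s0 dd0.
rewrite lt_min => /andP[Pd Pd'].
have lP : last 0 P = s by case: sP => _ /eqP.
have k1 := ds P sP Pd'.
have := dt _ (itv_partition_cat sP stQ); rewrite mesh_cat lP gt_max Pd Qd.
rewrite psum_cat lP => /(_ isT) k2.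
have -> : J t - J s - psum s Q Xi =
  (J t - (psum 0 P Xi + psum s Q Xi)) - (J s - psum 0 P Xi) by ring.
by apply: le_trans (ler_normB _ _) _; lra.
Qed.

(** Bounds that are uniform over partitions pass to the integral. *)
Lemma germ_bound T Xi J :
  (forall t, 0 <= t <= T -> psum 0 P Xi @[P --> mesh_to0 0 t] --> J t) ->
  forall s t x B, 0 <= s -> s <= t -> t <= T ->
  (forall Q, itv_partition s t Q -> `|psum s Q Xi - x| <= B) ->
  `|J t - J s - x| <= B.
Proof.
move=> HJ s t x B s0 st tT QB; apply/ler_addgt0Pr => e e0.
have t0T : 0 <= t <= T by rewrite (le_trans s0).
have [d d0 dt] := germ_approx HJ t0T e0.
have [Q stQ Qd] := ex_fine_partition st d0.
have k1 := dt s Q s0 stQ Qd; have k2 := QB Q stQ.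
have -> : J t - J s - x = (J t - J s - psum s Q Xi) + (psum s Q Xi - x) by ring.
by apply: le_trans (ler_normD _ _) _; lra.
Qed.

(** The single interval [s, t] is a partition of mesh t - s, so the uniform
    threshold of [germ_approx] gives the jumps of the integral. *)
Lemma germ_jump T Xi J :
  (forall t, 0 <= t <= T -> psum 0 P Xi @[P --> mesh_to0 0 t] --> J t) ->
  forall t e, 0 <= t <= T -> 0 < e ->
  exists2 d, 0 < d & forall s, 0 <= s -> s < t -> t - d < s ->
    `|J t - J s - Xi s t| <= e.
Proof.
move=> HJ t e tT e0; have [d d0 dt] := germ_approx HJ tT e0.
exists d => // s s0 st ds.
have := dt s _ s0 (itv_partition1 st); rewrite mesh_cons psum_cons psum_nil addr0.
by apply; rewrite /mesh big_nil gt_max d0 andbT; lra.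
Qed.

Lemma germ0 Xi (I : R) : psum 0 P Xi @[P --> mesh_to0 0 0] --> I -> I = 0.
Proof.
move=> H; apply: (germ_unique (lexx 0) H).
apply/cvgrPdist_le => e e0; exists 1 => //= P [/itv_partitionxx -> _].
by rewrite psum_nil subrr normr0 ltW.
Qed.

End GermIntegral.

(** * Differences of increments of smooth functions *)

Section Calculus.
Context {R : realType}.
Implicit Types (M S x y t : R) (f g : R -> R).

Definition bound_lip M f : Prop :=
  (forall x, `|f x| <= M) /\ (forall x y, `|f x - f y| <= M * `|x - y|).

Lemma mean_value_bound f f' (a b B : R) : a <= b ->
  (forall x, is_derive x 1 f (f' x)) ->
  (forall x, a <= x <= b -> `|f' x| <= B) -> `|f b - f a| <= B * (b - a).
Proof.
move=> ab df fB.
have [c cab ->] : exists2 c, c \in `[a, b]%R & f b - f a = f' c * (b - a).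
  apply: MVT_segment => // x_.
  by apply: derivable_within_continuous => x _; have [] := df x.
by rewrite normrM [`|b - a|]ger0_norm ?subr_ge0// ler_wpM2r ?subr_ge0 ?fB.
Qed.

Lemma lip_of_derive M f f' : (forall x, is_derive x 1 f (f' x)) ->
  (forall x, `|f' x| <= M) -> forall x y, `|f x - f y| <= M * `|x - y|.
Proof.
move=> df fM x y; have [xy|/ltW yx] := leP x y.
  rewrite distrC [`|x - y|]distrC (ger0_norm (_ : 0 <= y - x)) ?subr_ge0//.
  exact: mean_value_bound.
by rewrite (ger0_norm (_ : 0 <= x - y)) ?subr_ge0//; exact: mean_value_bound.
Qed.

Lemma derive_segment f f' (a b t : R) : (forall x, is_derive x 1 f (f' x)) ->
  is_derive t 1 (fun s => f (a + s * (b - a))) ((b - a) * f' (a + t * (b - a))).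
Proof.
move=> df.
have h : is_derive t 1 (fun s : R => a + s * (b - a)) (b - a).
  have -> : (fun s : R => a + s * (b - a)) = cst a + ((b - a) \*: @id R)%R.
    by apply/funext => s; rewrite !fctE /= /GRing.scale/= mulrC.
  by apply: is_derive_eq; rewrite add0r; exact: mulr1.
have := @is_derive1_comp _ f (fun s => a + s * (b - a)) t _ _ (df _) h.
by rewrite mulrC.
Qed.

Lemma convex_dist (a a' b b' S t : R) : `|a - b| <= S -> `|a' - b'| <= S ->
  0 <= t <= 1 -> `|a + t * (a' - a) - (b + t * (b' - b))| <= S.
Proof.
move=> h h' /andP[t0 t1].
have -> : a + t * (a' - a) - (b + t * (b' - b)) =
  (1 - t) * (a - b) + t * (a' - b') by ring.
rewrite (le_trans (ler_normD _ _))// !normrM (ger0_norm t0).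
rewrite (ger0_norm (_ : 0 <= 1 - t)) ?subr_ge0//.
have -> : S = (1 - t) * S + t * S by ring.
by rewrite lerD// ler_wpM2l// subr_ge0.
Qed.

(** Mean value bound for t |-> f (a + t (a' - a)) - f (b + t (b' - b)): its
    derivative differs from zero by the difference of the slopes and by the
    difference of the base points, the latter being at most S throughout. *)
Lemma double_diff M S f f' (a a' b b' : R) :
  (forall x, is_derive x 1 f (f' x)) -> bound_lip M f' ->
  `|a - b| <= S -> `|a' - b'| <= S ->
  `|(f a' - f a) - (f b' - f b)| <=
    M * (`|(a' - a) - (b' - b)| + `|b' - b| * S).
Proof.
move=> df [fM fL] h h'.
have M0 : 0 <= M := le_trans (normr_ge0 _) (fM 0).
pose psi t := f (a + t * (a' - a)) - f (b + t * (b' - b)).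
have dpsi t := is_deriveB (derive_segment a a' t df) (derive_segment b b' t df).
have -> : f a' - f a - (f b' - f b) = psi 1 - psi 0.
  by rewrite /psi !mul1r !mul0r !addr0 ![_ + (_ - _)]addrC !subrK; ring.
rewrite -[leRHS]mulr1 -[X in _ * X](subr0 1).
apply: (mean_value_bound ler01 dpsi) => t t01.
set A := a + _; set B := b + _.
have -> : (a' - a) * f' A - (b' - b) * f' B =
  ((a' - a) - (b' - b)) * f' A + (b' - b) * (f' A - f' B) by ring.
rewrite (le_trans (ler_normD _ _))// !normrM mulrDr lerD//.
  by rewrite mulrC ler_wpM2r.
rewrite mulrCA ler_wpM2l// (le_trans (fL _ _))// ler_wpM2l//.
exact: convex_dist.
Qed.

(** Same interpolation, applied to the first-order Taylor remainders; the
    derivative is estimated with [double_diff]. The Lipschitz bound on f''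
    is what a bounded third derivative is for. *)
Lemma taylor_diff M S f f' f'' (a a' b b' : R) :
  (forall x, is_derive x 1 f (f' x)) ->
  (forall x, is_derive x 1 f' (f'' x)) -> bound_lip M f'' ->
  `|a - b| <= S -> `|a' - b'| <= S ->
  `|(f a' - f a - f' a * (a' - a)) - (f b' - f b - f' b * (b' - b))| <=
    M * (`|(a' - a) - (b' - b)| * `|a' - a| +
         `|b' - b| * (`|(a' - a) - (b' - b)| + `|b' - b| * S)).
Proof.
move=> df df' fM h h'; have [fM1 fL] := fM.
have M0 : 0 <= M := le_trans (normr_ge0 _) (fM1 0).
pose phi (c c' t : R) := f (c + t * (c' - c)) - t * (f' c * (c' - c)).
have dphi c c' t : is_derive t 1 (phi c c')
    ((c' - c) * f' (c + t * (c' - c)) - f' c * (c' - c)).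
  have -> : phi c c' = (fun s => f (c + s * (c' - c))) -
      ((f' c * (c' - c)) \*: @id R)%R.
    by apply/funext => s; rewrite !fctE /= /GRing.scale/= [X in _ - X]mulrC.
  have h1 := derive_segment c c' t df.
  by apply: is_derive_eq; congr (_ - _); exact: mulr1.
have dpsi t := is_deriveB (dphi a a' t) (dphi b b' t).
have -> : (f a' - f a - f' a * (a' - a)) - (f b' - f b - f' b * (b' - b)) =
    (phi a a' - phi b b') 1 - (phi a a' - phi b b') 0.
  rewrite !fctE /phi !mul1r !mul0r !addr0 ![_ + (_ - _)]addrC !subrK; ring.
rewrite -[leRHS]mulr1 -[X in _ * X](subr0 1).
apply: (mean_value_bound ler01 dpsi) => t t01.
set A := a + _; set B := b + _.
have -> : (a' - a) * f' A - f' a * (a' - a) -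
    ((b' - b) * f' B - f' b * (b' - b)) =
  ((a' - a) - (b' - b)) * (f' A - f' a) +
  (b' - b) * ((f' A - f' a) - (f' B - f' b)) by ring.
have [t0 t1] := andP t01.
rewrite (le_trans (ler_normD _ _))// !normrM mulrDr lerD//.
  rewrite mulrCA ler_wpM2l// (le_trans (lip_of_derive df' fM1 _ _))//.
  rewrite ler_wpM2l// /A addrC addrA addNr add0r.
  by rewrite normrM ger0_norm// ler_piMl.
rewrite mulrCA ler_wpM2l//.
have := double_diff df' fM h (convex_dist h h' t01); rewrite -/A -/B.
move/le_trans; apply; rewrite ler_wpM2l//.
have -> : A - a - (B - b) = t * (a' - a - (b' - b)) by rewrite /A /B; ring.
have -> : B - b = t * (b' - b) by rewrite /B; ring.
rewrite !normrM (ger0_norm t0) lerD ?ler_piMl//.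
by rewrite ler_wpM2r ?ler_piMl// (le_trans _ h).
Qed.

Lemma bound_lipM M f g : bound_lip M f -> bound_lip M g ->
  bound_lip (2 * M ^+ 2) (fun x => f x * g x).
Proof.
move=> [fM fL] [gM gL].
have M0 : 0 <= M := le_trans (normr_ge0 _) (fM 0).
split=> [x|x y].
  rewrite normrM expr2 mulr_natl (@le_trans _ _ (M * M)) ?ler_pM//.
  by rewrite mulr2n lerDl mulr_ge0.
have -> : f x * g x - f y * g y = f x * (g x - g y) + (f x - f y) * g y by ring.
rewrite (le_trans (ler_normD _ _))// !normrM.
have -> : 2 * M ^+ 2 * `|x - y| = M * (M * `|x - y|) + M * `|x - y| * M by ring.
by rewrite lerD// ler_pM.
Qed.

Lemma bound_lipD M1 M2 f g : bound_lip M1 f -> bound_lip M2 g ->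
  bound_lip (M1 + M2) (fun x => f x + g x).
Proof.
move=> [fM fL] [gM gL]; split=> [x|x y].
  by rewrite (le_trans (ler_normD _ _))// lerD.
by rewrite opprD addrACA (le_trans (ler_normD _ _))// mulrDl lerD.
Qed.

End Calculus.

(** * Estimates of the linear and bilinear pairings *)

Section Pairings.
Context {R : realType} {d : nat}.

Lemma coord_le_norm m n (A : 'M[R]_(m, n)) i j : `|A i j| <= `|A|.
Proof. by rewrite [leRHS]/Num.Def.normr /= mx_normrE (le_bigmax _ _ (i, j)). Qed.

Lemma mxBE m n (A B : 'M[R]_(m, n)) i j : (A - B) i j = A i j - B i j.
Proof. by rewrite !mxE. Qed.

Lemma mxBE2 m n (A B C D : 'M[R]_(m, n)) i j :
  (A - B - (C - D)) i j = A i j - B i j - (C i j - D i j).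
Proof. by rewrite !mxE. Qed.

Lemma linform_le (a : 'rV[R]_d) (x : 'cV[R]_d) B :
  (forall j, `|a 0 j| <= B) -> `|linform a x| <= d%:R * B * `|x|.
Proof.
move=> aB; rewrite /linform mxE (le_trans (ler_norm_sum _ _ _))//.
have -> : d%:R * B * `|x| = \sum_(j < d) B * `|x|.
  by rewrite sumr_const card_ord -[RHS]mulr_natl mulrA.
by apply: ler_sum => j _; rewrite normrM ler_pM// coord_le_norm.
Qed.

Lemma bilform_le (A N : 'M[R]_d) B :
  (forall i j, `|A i j| <= B) -> `|bilform A N| <= d%:R ^+ 2 * B * `|N|.
Proof.
move=> AB; rewrite /bilform /mxtrace (le_trans (ler_norm_sum _ _ _))//.
have -> : d%:R ^+ 2 * B * `|N| = \sum_(i < d) \sum_(j < d) B * `|N|.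
  by rewrite !sumr_const !card_ord -[RHS]mulr_natl -[in RHS](mulr_natl (B * _)); ring.
apply: ler_sum => i _; rewrite mxE (le_trans (ler_norm_sum _ _ _))//.
by apply: ler_sum => j _; rewrite mxE normrM ler_pM// coord_le_norm.
Qed.

Lemma linformB (a b : 'rV[R]_d) (x : 'cV[R]_d) :
  linform (a - b) x = linform a x - linform b x.
Proof. by rewrite /linform mulmxBl !mxE. Qed.

Lemma linformZ k (a : 'rV[R]_d) (x : 'cV[R]_d) :
  linform (k *: a) x = k * linform a x.
Proof. by rewrite /linform -scalemxAl mxE. Qed.

Lemma linformDr (a : 'rV[R]_d) (x y : 'cV[R]_d) :
  linform a (x + y) = linform a x + linform a y.
Proof. by rewrite /linform mulmxDr !mxE. Qed.

Lemma bilformB (A B N : 'M[R]_d) :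
  bilform (A - B) N = bilform A N - bilform B N.
Proof. by rewrite /bilform linearB mulmxBl linearB. Qed.

Lemma bilformDr (A N N' : 'M[R]_d) :
  bilform A (N + N') = bilform A N + bilform A N'.
Proof. by rewrite /bilform mulmxDr linearD. Qed.

Lemma compform_coord (b a : 'rV[R]_d) i j :
  compform b a i j = a 0 i * b 0 j.
Proof. by rewrite /compform mxE big_ord1 mxE. Qed.

Lemma derive_coord (f : R -> 'rV[R]_d) x j : derivable f x 1 ->
  is_derive x 1 (fun y => f y 0 j) (derive1 f x 0 j).
Proof.
move=> df; rewrite derive1E (derive_mx df) mxE.
by apply: derivableP; exact: (derivable_mxP f x 1).1.
Qed.

End Pairings.

(** * The germ of the difference of two solutions *)

(** The algebra behind Chen's relation, with l and b in the roles of [linform]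
    and [bilform]. *)
Lemma pairing_defect {R : realType} {d : nat}
    (l : 'rV[R]_d -> 'cV[R]_d -> R) (b : 'M[R]_d -> 'M[R]_d -> R) :
  (forall a a' x, l (a - a') x = l a x - l a' x) ->
  (forall k a x, l (k *: a) x = k * l a x) ->
  (forall a x x', l a (x + x') = l a x + l a x') ->
  (forall A A' N, b (A - A') N = b A N - b A' N) ->
  (forall A N N', b A (N + N') = b A N + b A N') ->
  forall A A' a a' da x z P Q N, b A N = l a x * l da z ->
  l a (x + z) + b A (P + Q + N) - (l a x + b A P) - (l a' z + b A' Q) =
  - (l (a' - a - l a x *: da) z + b (A' - A) Q).
Proof.
move=> lB lZ lD bB bD A A' a a' da x z P Q N bN.
rewrite !lB lZ lD bB !bD bN; ring.
Qed.

Section Germ.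
Context {R : realType} {d : nat}.
Variables (X : R -> 'cV[R]_d) (XX : R -> R -> 'M[R]_d) (f : R -> 'rV[R]_d).
Implicit Types (Y : R -> R) (u m v x y : R).

Definition coef (y : R) : 'M[R]_d := compform (derive1 f y) (f y).

(** The summand of the rough integral of f(Y), for the derivative f(Y) of Y. *)
Definition germ Y u v : R :=
  linform (f (Y u)) (incr X u v) + bilform (coef (Y u)) (XX u v).

Definition remainder Y u v : R := incr Y u v - linform (f (Y u)) (incr X u v).

(** The remainder of the controlled path f(Y). *)
Definition field_remainder Y u m : 'rV[R]_d :=
  f (Y m) - f (Y u) - linform (f (Y u)) (incr X u m) *: derive1 f (Y u).

(** By Chen's relation, only the remainder of f(Y) and the increment of its
    derivative survive. *)
Lemma germ_defect Y u m v :
  XX u v - XX u m - XX m v = incr X u m *m (incr X m v)^T ->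
  germ Y u v - germ Y u m - germ Y m v =
  - (linform (field_remainder Y u m) (incr X m v) +
     bilform (coef (Y m) - coef (Y u)) (XX m v)).
Proof.
move=> chen.
have XE : incr X u v = incr X u m + incr X m v by rewrite /incr [RHS]addrC subrKA.
have XXE : XX u v = XX u m + XX m v + incr X u m *m (incr X m v)^T.
  by rewrite -chen -[XX u v - _ - _]addrA -opprD [_ + (_ - _)]addrC subrK.
rewrite /germ XE XXE.
apply: (pairing_defect linformB linformZ linformDr bilformB bilformDr).
by rewrite bilform_tensor /coef compformE linformZ.
Qed.

Lemma incr_diag {E : normedModType R} (Z : R -> E) s : incr Z s s = 0.
Proof. by rewrite /incr subrr. Qed.

Lemma remainder_diag Y s : remainder Y s s = 0.
Proof. by rewrite /remainder !incr_diag /linform mulmx0 mxE subrr. Qed.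

Lemma chen_diag s :
  XX s s - XX s s - XX s s = incr X s s *m (incr X s s)^T -> XX s s = 0.
Proof.
by rewrite incr_diag mul0mx subrr sub0r => /eqP; rewrite oppr_eq0 => /eqP.
Qed.

Definition smooth_field (M : R) : Prop :=
  [/\ 1 <= M,
      forall j x, is_derive x 1 (fun y => f y 0 j) (derive1 f x 0 j),
      forall j x, is_derive x 1 (fun y => derive1 f y 0 j) (derive1n 2 f x 0 j)
    & forall j, [/\ bound_lip M (fun y => f y 0 j),
        bound_lip M (fun y => derive1 f y 0 j) &
        bound_lip M (fun y => derive1n 2 f y 0 j)]].

Lemma smooth_field_Cb3 : Cb 3 f -> exists M, smooth_field M.
Proof.
move=> [fd fb].
have df j k x : (k < 3)%N -> is_derive x 1 (fun y => derive1n k f y 0 j)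
    (derive1n k.+1 f x 0 j).
  by move=> k3; rewrite derive1nS; exact/derive_coord/fd.
have fB k : (k <= 3)%N -> exists M, forall x, `|derive1n k f x| <= M.
  by move=> k3; have [_] := fb k k3.
have [M0 h0] := fB 0 isT; have [M1 h1] := fB 1 isT.
have [M2 h2] := fB 2 isT; have [M3 h3] := fB 3 isT.
pose M := 1 + M0 + M1 + M2 + M3.
have p0 : 0 <= M0 := le_trans (normr_ge0 _) (h0 0).
have p1 : 0 <= M1 := le_trans (normr_ge0 _) (h1 0).
have p2 : 0 <= M2 := le_trans (normr_ge0 _) (h2 0).
have p3 : 0 <= M3 := le_trans (normr_ge0 _) (h3 0).
have g0 x j : `|derive1n 0 f x 0 j| <= M.
  by rewrite (le_trans (coord_le_norm _ _ _))// (le_trans (h0 x))// /M; lra.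
have g1 x j : `|derive1n 1 f x 0 j| <= M.
  by rewrite (le_trans (coord_le_norm _ _ _))// (le_trans (h1 x))// /M; lra.
have g2 x j : `|derive1n 2 f x 0 j| <= M.
  by rewrite (le_trans (coord_le_norm _ _ _))// (le_trans (h2 x))// /M; lra.
have g3 x j : `|derive1n 3 f x 0 j| <= M.
  by rewrite (le_trans (coord_le_norm _ _ _))// (le_trans (h3 x))// /M; lra.
exists M; split.
- by rewrite /M; lra.
- by move=> j x; exact: (df j 0%N).
- by move=> j x; exact: (df j 1%N).
move=> j; split; split.
- by move=> x; exact: g0.
- exact: (@lip_of_derive _ M _ _ (fun x => df j 0%N x isT) (fun x => g1 x j)).
- by move=> x; exact: g1.
- exact: (@lip_of_derive _ M _ _ (fun x => df j 1%N x isT) (fun x => g2 x j)).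
- by move=> x; exact: g2.
- exact: (@lip_of_derive _ M _ _ (fun x => df j 2%N x isT) (fun x => g3 x j)).
Qed.

Section SmoothField.
Variable M : R.
Hypothesis fM : smooth_field M.

Let M1 : 1 <= M. Proof. by case: fM. Qed.
Let M0 : 0 <= M. Proof. exact: le_trans M1. Qed.

Lemma field_lip (x y : R) j : `|(f x - f y) 0 j| <= M * `|x - y|.
Proof. by case: fM => _ _ _ /(_ j)[[_ h] _ _]; rewrite !mxE; exact: h. Qed.

Lemma coef_lip (x y : R) i j :
  `|(coef x - coef y) i j| <= 2 * M ^+ 2 * `|x - y|.
Proof.
case: fM => _ _ _ h; have [h1 _ _] := h i; have [_ h2 _] := h j.
have : bound_lip (2 * M ^+ 2) (fun y => coef y i j).
  rewrite (_ : (fun y => coef y i j) = fun y => f y 0 i * derive1 f y 0 j).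
    exact: bound_lipM.
  by apply/funext => z; exact: compform_coord.
by move=> [_ /(_ x y)]; rewrite mxBE.
Qed.

Lemma coef_double_diff S (a a' b b' : R) i j : `|a - b| <= S -> `|a' - b'| <= S ->
  `|(coef a' - coef a - (coef b' - coef b)) i j| <=
    4 * M ^+ 2 * (`|(a' - a) - (b' - b)| + `|b' - b| * S).
Proof.
move=> ab ab'; case: fM => _ df df' h.
have [h1 h2 _] := h i; have [_ k2 k3] := h j.
pose g y := f y 0 i * derive1 f y 0 j.
have dg x : is_derive x 1 g
    (derive1 f x 0 i * derive1 f x 0 j + f x 0 i * derive1n 2 f x 0 j).
  have D1 := df i x; have D2 := df' j x.
  have -> : g = (fun y => f y 0 i) * (fun y => derive1 f y 0 j) by [].
  by apply: is_derive_eq; rewrite /GRing.scale /= mulrC addrC [X in X + _]mulrC.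
have -> : 4 * M ^+ 2 = 2 * M ^+ 2 + 2 * M ^+ 2 by ring.
have dh x : is_derive x 1 (fun y => coef y i j)
    (derive1 f x 0 i * derive1 f x 0 j + f x 0 i * derive1n 2 f x 0 j).
  by rewrite (_ : (fun y => coef y i j) = g)//; apply/funext => y;
     exact: compform_coord.
rewrite mxBE2.
exact: double_diff dh (bound_lipD (bound_lipM h2 k2) (bound_lipM h1 k3)) ab ab'.
Qed.

Lemma coef_norm_lip S (x y : R) N : `|x - y| <= S ->
  `|bilform (coef x - coef y) N| <= d%:R ^+ 2 * (2 * M ^+ 2 * S) * `|N|.
Proof.
move=> xy; apply: bilform_le => i j; apply: le_trans (coef_lip _ _ _ _) _.
by rewrite ler_wpM2l// mulr_ge0// exprn_ge0.
Qed.

Lemma field_remainder_coord Y u m j : field_remainder Y u m 0 j =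
  (f (Y m) 0 j - f (Y u) 0 j - derive1 f (Y u) 0 j * (Y m - Y u)) +
  derive1 f (Y u) 0 j * remainder Y u m.
Proof. by rewrite /field_remainder /remainder /incr 5!mxE; ring. Qed.

(** In this section e stands for the size of a control to the power 1 / p, so
    that X is of order e, and XX and the remainders of order e ^ 2; kappa is the
    smallness of the data, while the difference of the two remainders is only
    N e ^ 2. The bounds are kept linear in N, and the last one gains the factor
    kappa. *)
Section Defect.
Variables (Y1 Y2 : R -> R) (u m v N kappa e : R).
Hypotheses (d1 : (1 <= d)%N) (k0 : 0 <= kappa) (k1 : kappa <= 1).
Hypotheses (e0 : 0 <= e) (e2 : e <= 2) (N0 : 0 <= N).
Hypothesis HXum : `|incr X u m| <= kappa * e.
Hypothesis HY1 : `|incr Y1 u m| <= kappa * e.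
Hypothesis HY2 : `|incr Y2 u m| <= kappa * e.
Hypothesis HR2 : `|remainder Y2 u m| <= kappa * e ^+ 2.
Hypothesis HRZ : `|remainder Y1 u m - remainder Y2 u m| <= N * e ^+ 2.
Hypothesis Zu : `|Y1 u - Y2 u| <= 4 * N.
Hypothesis Zm : `|Y1 m - Y2 m| <= 4 * N.

Let D : R := d%:R.
Let D1 : 1 <= D. Proof. by rewrite ler1n. Qed.
Let D0 : 0 <= D. Proof. exact: le_trans D1. Qed.
Let DM1 : 1 <= D * M.
Proof. by rewrite -[1]mulr1 ler_pM. Qed.
Let ke : kappa * e <= e.
Proof. by rewrite ler_piMl. Qed.
Let ke2 : kappa * e ^+ 2 <= e ^+ 2.
Proof. by rewrite ler_piMl// exprn_ge0. Qed.

(** The increment of Z is its first-order part plus the difference of the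
    remainders. *)
Lemma increment_diff_bound :
  `|(Y1 m - Y1 u) - (Y2 m - Y2 u)| <= (4 * (D * M) + 2) * (N * e).
Proof.
have -> : (Y1 m - Y1 u) - (Y2 m - Y2 u) =
    linform (f (Y1 u) - f (Y2 u)) (incr X u m) +
    (remainder Y1 u m - remainder Y2 u m).
  by rewrite linformB /remainder /incr; ring.
apply: le_trans (ler_normD _ _) _; rewrite mulrDl lerD//; last first.
  apply: le_trans HRZ _; rewrite expr2 [leRHS]mulrC -mulrA ler_wpM2l//.
  by rewrite ler_wpM2l.
have h j : `|(f (Y1 u) - f (Y2 u)) 0 j| <= M * (4 * N).
  by apply: le_trans (field_lip _ _ _) _; rewrite ler_wpM2l.
apply: le_trans (linform_le _ h) _.
have -> : 4 * (D * M) * (N * e) = D * (M * (4 * N)) * e by ring.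
by rewrite ler_wpM2l ?(le_trans HXum)// !mulr_ge0.
Qed.

(** The remainder of f(Y) is a Taylor remainder of f plus f'(Y) times the
    remainder of Y; both are compared for the two paths. *)
Lemma field_remainder_diff_bound j :
  `|(field_remainder Y1 u m - field_remainder Y2 u m) 0 j| <=
    21 * (D * M) * (M * (N * e ^+ 2)).
Proof.
have -> : (field_remainder Y1 u m - field_remainder Y2 u m) 0 j =
    (f (Y1 m) 0 j - f (Y1 u) 0 j - derive1 f (Y1 u) 0 j * (Y1 m - Y1 u)) +
    derive1 f (Y1 u) 0 j * remainder Y1 u m -
    ((f (Y2 m) 0 j - f (Y2 u) 0 j - derive1 f (Y2 u) 0 j * (Y2 m - Y2 u)) +
    derive1 f (Y2 u) 0 j * remainder Y2 u m).
  etransitivity; first exact: mxBE.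
  by congr (_ - _); exact: field_remainder_coord.
case: fM => _ df df' h; have [_ h1 h2] := h j.
have T := taylor_diff (df j) (df' j) h2 Zu Zm.
set t1 := _ - _ * (Y1 m - Y1 u) in T *; set t2 := _ - _ * (Y2 m - Y2 u) in T *.
set p1 := derive1 f (Y1 u) 0 j; set p2 := derive1 f (Y2 u) 0 j.
have -> : t1 + p1 * remainder Y1 u m - (t2 + p2 * remainder Y2 u m) =
  (t1 - t2) + (p1 * (remainder Y1 u m - remainder Y2 u m) +
  (p1 - p2) * remainder Y2 u m) by ring.
have a1 : `|p1 * (remainder Y1 u m - remainder Y2 u m)| <= M * (N * e ^+ 2).
  by rewrite normrM ler_pM// h1.1.
have a2 : `|(p1 - p2) * remainder Y2 u m| <= M * (4 * N) * e ^+ 2.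
  rewrite normrM ler_pM ?(le_trans HR2)//.
  by apply: le_trans (h1.2 _ _) _; rewrite ler_wpM2l.
have a3 : `|t1 - t2| <= M * ((4 * (D * M) + 2) * (N * e) * e +
    e * ((4 * (D * M) + 2) * (N * e) + e * (4 * N))).
  apply: le_trans T _; rewrite ler_wpM2l//.
  have y1 : `|Y1 m - Y1 u| <= e := le_trans HY1 ke.
  have y2 : `|Y2 m - Y2 u| <= e := le_trans HY2 ke.
  have iz := increment_diff_bound.
  have z0 : 0 <= 4 * N by rewrite mulr_ge0.
  apply: lerD; first exact: ler_pM.
  apply: ler_pM => //; first by rewrite addr_ge0// mulr_ge0.
  by rewrite lerD// ler_pM.
have MNe : 0 <= M * (N * e ^+ 2) by rewrite !mulr_ge0 ?exprn_ge0.
have a4 := ler_wpM2r MNe DM1.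
have a5 : M * ((4 * (D * M) + 2) * (N * e) * e +
    e * ((4 * (D * M) + 2) * (N * e) + e * (4 * N))) =
  8 * ((D * M) * (M * (N * e ^+ 2))) + 8 * (M * (N * e ^+ 2)) by ring.
have a6 : M * (4 * N) * e ^+ 2 = 4 * (M * (N * e ^+ 2)) by ring.
rewrite a5 in a3; rewrite a6 in a2; rewrite -[leRHS]mulrA.
move: (p1 * _) ((p1 - p2) * _) (t1 - t2) a1 a2 a3 => q1 q2 q3 a1 a2 a3.
have := ler_normD q3 (q1 + q2); have := ler_normD q1 q2; lra.
Qed.

(** The order 3 in e, which beats p, is what makes sewing possible. *)
Lemma germ_diff_defect :
  XX u v - XX u m - XX m v = incr X u m *m (incr X m v)^T ->
  `|incr X m v| <= kappa * e -> `|XX m v| <= kappa * e ^+ 2 ->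
  `|(germ Y1 u v - germ Y2 u v) - (germ Y1 u m - germ Y2 u m) -
    (germ Y1 m v - germ Y2 m v)| <= 61 * (D * M) ^+ 3 * kappa * N * e ^+ 3.
Proof.
move=> chen HXmv HXXmv.
have regroup (x x' y y' z z' l l' c c' B B' : R) :
    x - y - z = - (l + c) -> x' - y' - z' = - (l' + c') ->
    `|l - l'| <= B -> `|c - c'| <= B' ->
    `|(x - x') - (y - y') - (z - z')| <= B + B'.
  move=> h h' hl hc.
  have -> : (x - x') - (y - y') - (z - z') = - ((l - l') + (c - c')) by lra.
  by rewrite normrN; apply: le_trans (ler_normD _ _) (lerD hl hc).
have b1 := linform_le (incr X m v) field_remainder_diff_bound.
have b2 : `|bilform (coef (Y1 m) - coef (Y1 u) - (coef (Y2 m) - coef (Y2 u)))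
    (XX m v)| <= D ^+ 2 * (40 * (D * M) * M ^+ 2 * (N * e)) * `|XX m v|.
  apply: bilform_le => i j; apply: le_trans (coef_double_diff _ _ Zu Zm) _.
  have y2 : `|Y2 m - Y2 u| <= e := le_trans HY2 ke.
  have iz := increment_diff_bound.
  have -> : 40 * (D * M) * M ^+ 2 * (N * e) =
    4 * M ^+ 2 * (10 * (D * M) * (N * e)) by ring.
  rewrite ler_wpM2l ?mulr_ge0 ?exprn_ge0//.
  have y3 : `|Y2 m - Y2 u| * (4 * N) <= e * (4 * N).
    by rewrite ler_wpM2r// mulr_ge0.
  have y4 := ler_wpM2r (mulr_ge0 N0 e0) DM1.
  rewrite -[10 * _ * _]mulrA; lra.
rewrite linformB in b1; rewrite bilformB in b2.
have b3 : D * (21 * (D * M) * (M * (N * e ^+ 2))) * `|incr X m v| <=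
    D * (21 * (D * M) * (M * (N * e ^+ 2))) * (kappa * e).
  by rewrite ler_wpM2l// !mulr_ge0// exprn_ge0.
have b4 : D ^+ 2 * (40 * (D * M) * M ^+ 2 * (N * e)) * `|XX m v| <=
    D ^+ 2 * (40 * (D * M) * M ^+ 2 * (N * e)) * (kappa * e ^+ 2).
  by rewrite ler_wpM2l// !mulr_ge0 ?exprn_ge0.
apply: le_trans (regroup _ _ _ _ _ _ _ _ _ _ _ _ (germ_defect Y1 chen)
  (germ_defect Y2 chen) (le_trans b1 b3) (le_trans b2 b4)) _.
have c0 : 0 <= (D * M) ^+ 2 * (kappa * N * e ^+ 3).
  by rewrite !mulr_ge0 ?exprn_ge0// mulr_ge0.
have c3 := ler_wpM2r c0 DM1.
have -> : D * (21 * (D * M) * (M * (N * e ^+ 2))) * (kappa * e) =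
  21 * ((D * M) ^+ 2 * (kappa * N * e ^+ 3)) by ring.
have -> : D ^+ 2 * (40 * (D * M) * M ^+ 2 * (N * e)) * (kappa * e ^+ 2) =
  40 * (D * M * ((D * M) ^+ 2 * (kappa * N * e ^+ 3))) by ring.
have -> : 61 * (D * M) ^+ 3 * kappa * N * e ^+ 3 =
  61 * (D * M * ((D * M) ^+ 2 * (kappa * N * e ^+ 3))) by ring.
lra.
Qed.

End Defect.

End SmoothField.
End Germ.

(** * Excursions of one solution above the other *)

Section Excursion.
Context {R : realType} {d : nat}.
Variables (X : R -> 'cV[R]_d) (XX : R -> R -> 'M[R]_d) (f : R -> 'rV[R]_d).
Variables (M p : R).

(** Eight times the constant of the sewing error, 61 being that of
    [germ_diff_defect] and 8 bounding E ^ 3 below, plus the constant of the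
    second-order part of the germ. *)
Definition excursion_const : R :=
  8 * (sewing_const (3 / p) * (61 * (d%:R * M) ^+ 3)) + 8 * (d%:R * M) ^+ 2.

Hypotheses (p2 : 2 <= p) (p3 : p < 3).

Lemma excursion_const_ge0 : 0 <= M -> 0 <= excursion_const.
Proof.
move=> M0; have := @sewing_const_ge0 R (3 / p).
have p0 : 0 < p by have := p2; lra.
rewrite ltr_pdivlMr ?mul1r// => /(_ p3) s0; rewrite /excursion_const.
have DM0 : 0 <= d%:R * M by exact: mulr_ge0.
apply: addr_ge0; apply: mulr_ge0 => //; last exact: exprn_ge0.
apply: mulr_ge0 s0 _; apply: mulr_ge0 (exprn_ge0 _ DM0); exact: ler0n.
Qed.

Hypotheses (d1 : (1 <= d)%N) (fM : smooth_field f M).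
Variables (a b kappa : R) (omega : R -> R -> R) (Y1 Y2 J K : R -> R).
Hypotheses (ab : a <= b) (k0 : 0 < kappa) (k1 : kappa <= 1).
Hypothesis kC : excursion_const * kappa <= 1 / 13.
Hypothesis omegaC : control a b omega.
Hypothesis omegak : omega a b <= kappa `^ p.
Let on (H : R -> R -> Prop) :=
  forall u v, a <= u -> u <= v -> v <= b -> H u v.
Hypothesis HX : on (fun u v => `|incr X u v| `^ p <= omega u v).
Hypothesis HXX : on (fun u v => `|XX u v| `^ (p / 2) <= omega u v).
Hypothesis HY1 : on (fun u v => `|incr Y1 u v| `^ p <= omega u v).
Hypothesis HY2 : on (fun u v => `|incr Y2 u v| `^ p <= omega u v).
Hypothesis HR2 : on (fun u v => `|remainder X f Y2 u v| `^ (p / 2) <= omega u v).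
Let RZ u v := remainder X f Y1 u v - remainder X f Y2 u v.
Hypothesis HRZ : finvar (p / 2) a b RZ.
Hypothesis chen : forall u m v, a <= u -> u <= m -> m <= v -> v <= b ->
  XX u v - XX u m - XX m v = incr X u m *m (incr X m v)^T.
Let Xi u v := germ X XX f Y1 u v - germ X XX f Y2 u v.
(* J is the integral of the germ Xi: bounds that are uniform over partitions
   pass to its increments. *)
Hypothesis HJ : on (fun u v => forall x B,
  (forall Q, itv_partition u v Q -> `|psum u Q Xi - x| <= B) ->
  `|J v - J u - x| <= B).
Hypothesis HK : on (fun u v => K u <= K v).
(* K is the reflection term of Y2; that of Y1 is constant on [a, b]. *)
Hypothesis HZ : on (fun u v =>
  (Y1 v - Y2 v) - (Y1 u - Y2 u) = J v - J u - (K v - K u)).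
Hypotheses (Ya : Y1 a = Y2 a) (Yb : Y2 b <= Y1 b).

Let M1 : 1 <= M. Proof. by case: fM. Qed.
Let M0 : 0 <= M. Proof. exact: le_trans M1. Qed.
Let p0 : 0 < p. Proof. by have := p2; lra. Qed.
Let p20 : 0 < p / 2. Proof. by have := p2; lra. Qed.
Let DM0 : 0 <= d%:R * M. Proof. exact: mulr_ge0. Qed.

Let RZ0 u : RZ u u = 0.
Proof.
by rewrite /RZ !remainder_diag subrr.
Qed.

Let Z_RZ u : a <= u -> u <= b -> Y1 u - Y2 u = RZ a u.
Proof. by move=> au ub; rewrite /RZ /remainder /incr Ya; ring. Qed.

(* The unknown of the argument: N below is its norm, V = N ^ (p / 2). *)
Let V := pvar (p / 2) RZ a b.

Let pv := pvar_control HRZ.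

Lemma excursion_null : V = 0 -> forall u, a <= u -> u <= b -> Y1 u = Y2 u.
Proof.
move=> V0 u au ub; apply/eqP; rewrite -subr_eq0 Z_RZ//.
have h1 := le_pvar p20 HRZ (fun s _ _ => RZ0 s) (lexx a) au ub.
have h2 := control_le pv (lexx a) (lexx a) au ub (lexx b).
have : `|RZ a u| `^ (p / 2) = 0.
  apply/eqP; rewrite eq_le powR_ge0 andbT -V0; exact: le_trans h2.
by move/powR_eq0_eq0/eqP; rewrite normr_eq0.
Qed.

Section Positive.
Hypothesis V0 : 0 < V.

Let N : R := V `^ (p / 2)^-1.
Let N0 : 0 < N. Proof. exact: powR_gt0. Qed.
Let NV : N `^ (p / 2) = V. Proof. by rewrite /N powRK// ltW. Qed.

(* The two summands have mass at most 1 on [a, b]; they are normalized so that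
   data of order kappa E and remainders of order N E ^ 2 are measured by the
   same E. *)
Let W u v : R := V^-1 * pvar (p / 2) RZ u v + kappa `^ (- p) * omega u v.
Let E u v : R := W u v `^ p^-1.

Let WC : control a b W.
Proof.
apply: controlD; apply: controlZ => //; first by rewrite invr_ge0 ltW.
exact: powR_ge0.
Qed.

Let W0 : on (fun u v => 0 <= W u v). Proof. exact: WC.1. Qed.

Let kpN : kappa `^ p * kappa `^ (- p) = 1.
Proof. by rewrite powRN mulfV// gt_eqF// powR_gt0. Qed.

Let Wab : W a b <= 2.
Proof.
rewrite /W mulVf ?gt_eqF// (_ : 2 = 1 + 1)// lerD2l mulrC -kpN.
by rewrite ler_wpM2r ?powR_ge0.
Qed.

Let E0 u v : 0 <= E u v. Proof. exact: powR_ge0. Qed.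

Let Ele u v u' v' : a <= u -> u <= u' -> u' <= v' -> v' <= v -> v <= b ->
  E u' v' <= E u v.
Proof.
move=> au uu' uv' vv' vb; rewrite ge0_ler_powR ?nnegrE ?invr_ge0 ?(ltW p0)//.
- by apply: W0; lra.
- by apply: W0; lra.
- by apply: (control_le WC).
Qed.

Let E2 : on (fun u v => E u v <= 2).
Proof.
move=> u v au uv vb; apply: (@le_trans _ _ (E a b)); first exact: Ele.
apply: (@le_trans _ _ (2 `^ p^-1)).
  by rewrite ge0_ler_powR ?nnegrE ?invr_ge0 ?(ltW p0)// W0.
rewrite -[leRHS]powRr1// ler_powR ?ler1n//.
by rewrite invf_le1//; have := p2; lra.
Qed.

Let E3W : on (fun u v => E u v ^+ 3 = W u v `^ (3 / p)).
Proof.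
by move=> u v *; rewrite -powR_mulrn ?powR_ge0// -powRrM mulrC.
Qed.

Let E2W : on (fun u v => E u v ^+ 2 = W u v `^ (p / 2)^-1).
Proof.
by move=> u v *; rewrite -powR_mulrn ?powR_ge0// -powRrM invfM invrK.
Qed.

Let omegaW : on (fun u v => omega u v <= kappa `^ p * W u v).
Proof.
move=> u v au uv vb; rewrite /W mulrDr mulrA [kappa `^ p * (_ * _)]mulrA kpN.
rewrite mul1r lerDr !mulr_ge0 ?powR_ge0 ?invr_ge0 ?(ltW V0)//.
exact: pv.1.
Qed.

Let order1 u v (x : R) : a <= u -> u <= v -> v <= b -> 0 <= x ->
  x `^ p <= omega u v -> x <= kappa * E u v.
Proof.
move=> au uv vb x0 xw; apply: powR_root_le => //; first exact: ltW.
  exact: W0.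
by apply: le_trans xw _; exact: omegaW.
Qed.

Let order2 u v (x : R) : a <= u -> u <= v -> v <= b -> 0 <= x ->
  x `^ (p / 2) <= omega u v -> x <= kappa * E u v ^+ 2.
Proof.
move=> au uv vb x0 xw; have kk : kappa ^+ 2 <= kappa.
  by rewrite expr2 ler_piMl// ltW.
apply: (@le_trans _ _ (kappa ^+ 2 * E u v ^+ 2)); last first.
  by rewrite ler_wpM2r// exprn_ge0.
rewrite E2W//; apply: powR_root_le => //; first exact/exprn_ge0/ltW.
  exact: W0.
apply: le_trans xw _; rewrite -powR_mulrn ?(ltW k0)// -powRrM.
by rewrite (_ : 2%:R * (p / 2) = p); [exact: omegaW|field].
Qed.

Let orderRZ : on (fun u v => `|RZ u v| <= N * E u v ^+ 2).
Proof.
move=> u v au uv vb; rewrite E2W//; apply: powR_root_le => //.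
- exact: ltW.
- exact: W0.
rewrite NV; apply: le_trans (le_pvar p20 HRZ (fun s _ _ => RZ0 s) au uv vb) _.
rewrite /W mulrDr mulVKf ?gt_eqF// lerDl !mulr_ge0 ?powR_ge0 ?(ltW V0)//.
exact: omegaC.1.
Qed.

Let Zle u : a <= u -> u <= b -> `|Y1 u - Y2 u| <= 4 * N.
Proof.
move=> au ub; rewrite Z_RZ//; apply: le_trans (orderRZ _ au ub) _ => //.
rewrite mulrC ler_wpM2r ?(ltW N0)//.
rewrite (_ : 4 = 2 ^+ 2 :> R); last by ring.
by rewrite ler_pXn2r ?nnegrE// E2.
Qed.

Let c : R := 61 * (d%:R * M) ^+ 3 * kappa * N.
Let c0 : 0 <= c.
Proof. by rewrite /c !mulr_ge0 ?exprn_ge0// ltW. Qed.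

Let Xi_defect u m v : a <= u -> u <= m -> m <= v -> v <= b ->
  `|Xi u v - Xi u m - Xi m v| <= c * W u v `^ (3 / p).
Proof.
move=> au um mv vb.
have uv := le_trans um mv; have am := le_trans au um; have mb := le_trans mv vb.
rewrite -E3W//.
have Eum : E u m <= E u v by apply: Ele.
have Emv : E m v <= E u v by apply: Ele.
have ex (x y : R) : 0 <= x -> x <= y -> x ^+ 2 <= y ^+ 2.
  by move=> x0 xy; rewrite ler_pXn2r ?nnegrE// (le_trans x0).
have o1 (x y z : R) : x <= kappa * y -> y <= z -> x <= kappa * z.
  by move=> xy yz; apply: le_trans xy _; rewrite ler_wpM2l// ltW.
have o2 (k x y z : R) : 0 <= k -> 0 <= y -> x <= k * y ^+ 2 -> y <= z ->
    x <= k * z ^+ 2.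
  by move=> k0' y0 xy yz; apply: le_trans xy _; rewrite ler_wpM2l// ex.
apply: (germ_diff_defect fM d1 (ltW k0) k1 (E0 u v) (E2 au uv vb) (ltW N0)).
- exact: o1 (order1 au um mb (normr_ge0 _) (HX au um mb)) Eum.
- exact: o1 (order1 au um mb (normr_ge0 _) (HY1 au um mb)) Eum.
- exact: o1 (order1 au um mb (normr_ge0 _) (HY2 au um mb)) Eum.
- exact: o2 (ltW k0) (E0 _ _) (order2 au um mb (normr_ge0 _) (HR2 au um mb)) Eum.
- exact: o2 (ltW N0) (E0 _ _) (orderRZ au um mb) Eum.
- exact: Zle (le_trans um mb).
- exact: Zle.
- exact: chen.
- exact: o1 (order1 am mv vb (normr_ge0 _) (HX am mv vb)) Emv.
- exact: o2 (ltW k0) (E0 _ _) (order2 am mv vb (normr_ge0 _) (HXX am mv vb)) Emv.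
Qed.

Let Xi0 u : a <= u -> u <= b -> Xi u u = 0.
Proof.
move=> au ub; have := Xi_defect au (lexx _) (lexx _) ub.
rewrite (control_diag WC au ub) powR0; last first.
  by rewrite mulf_neq0 ?invr_neq0 ?gt_eqF.
rewrite mulr0 normr_le0 subrr add0r oppr_eq0 => /eqP//.
Qed.

Let s := sewing_const (3 / p).
Let p31 : 1 < 3 / p. Proof. by rewrite ltr_pdivlMr ?mul1r. Qed.
Let s0 : 0 <= s. Proof. exact: sewing_const_ge0. Qed.

Let J_Xi : on (fun u v => `|J v - J u - Xi u v| <= s * c * E u v ^+ 3).
Proof.
move=> u v au uv vb; apply: HJ => // Q uvQ; rewrite E3W//.
exact: (sewing p31 c0 WC Xi0 Xi_defect).
Qed.

Let D0 : R := excursion_const * kappa * N.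

Let D0E : D0 = 8 * (s * c) + 8 * ((d%:R * M) ^+ 2 * kappa * N).
Proof. by rewrite /D0 /excursion_const /c -/s; ring. Qed.

Let sc0 : 0 <= s * c. Proof. exact: mulr_ge0. Qed.
Let b0 : 0 <= (d%:R * M) ^+ 2 * kappa * N.
Proof. by rewrite !mulr_ge0 ?exprn_ge0// ltW. Qed.

(* The germ from a to b vanishes because Y1 a = Y2 a, and Z b >= 0: the growth of
   K is paid for by the sewing error alone. *)
Let Kab : K b - K a <= D0.
Proof.
have h := HZ (lexx a) ab (lexx b).
have := J_Xi (lexx a) ab (lexx b).
have -> : Xi a b = 0 by rewrite /Xi /germ Ya subrr.
have e3 : E a b ^+ 3 <= 8.
  rewrite (_ : 8 = 2 ^+ 3 :> R); last by ring.
  by rewrite ler_pXn2r ?nnegrE// E2.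
have h2 := ler_wpM2l sc0 e3.
rewrite subr0 => /ler_normlP[_ h3].
have := Yb; have := Ya; have := b0; rewrite D0E; lra.
Qed.

Let RZ_le : on (fun u v => `|RZ u v| <= D0 * E u v ^+ 2 + (K v - K u)).
Proof.
move=> u v au uv vb.
have ub := le_trans uv vb.
have i1 := J_Xi au uv vb; have i2 := HK au uv vb; have i3 := HZ au uv vb.
have i4 := coef_norm_lip fM (XX u v) (Zle au ub).
have i5 := order2 au uv vb (normr_ge0 _) (HXX au uv vb).
have i6 : `|bilform (coef f (Y1 u)) (XX u v) - bilform (coef f (Y2 u)) (XX u v)|
    <= 8 * ((d%:R * M) ^+ 2 * kappa * N) * E u v ^+ 2.
  rewrite -bilformB; apply: le_trans i4 _.
  have -> : 8 * ((d%:R * M) ^+ 2 * kappa * N) * E u v ^+ 2 =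
    d%:R ^+ 2 * (2 * M ^+ 2 * (4 * N)) * (kappa * E u v ^+ 2) by ring.
  by rewrite ler_wpM2l// !mulr_ge0 ?exprn_ge0// ltW.
have i7 : s * c * E u v ^+ 3 <= 8 * (s * c) * E u v ^+ 2.
  have -> : 8 * (s * c) * E u v ^+ 2 = s * c * (E u v ^+ 2 * 8) by ring.
  rewrite ler_wpM2l// exprSr ler_wpM2l ?exprn_ge0//.
  by apply: le_trans (E2 au uv vb) _; lra.
have regroup (z j l1 l2 b1 b2 k B1 B2 : R) :
    `|j - (l1 + b1 - (l2 + b2))| <= B1 -> `|b1 - b2| <= B2 -> 0 <= k ->
    z = j - k -> `|z - (l1 - l2)| <= B1 + B2 + k.
  move=> h1 h2 kk ->.
  have -> : j - k - (l1 - l2) = (j - (l1 + b1 - (l2 + b2))) + (b1 - b2) - k.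
    by lra.
  apply: le_trans (ler_normB _ _) _; rewrite (ger0_norm kk) lerD2r.
  by apply: le_trans (ler_normD _ _) (lerD h1 h2).
have K0 : 0 <= K v - K u by rewrite subr_ge0.
have := regroup _ _ _ _ _ _ _ _ _ (le_trans i1 i7) i6 K0 i3.
rewrite -mulrDl -D0E; congr (`|_| <= _).
rewrite /RZ /remainder /incr.
have aux (y1 y1' y2 y2' l1 l2 : R) :
  y1 - y2 - (y1' - y2') - (l1 - l2) = (y1 - y1') - l1 - ((y2 - y2') - l2) by ring.
exact: aux.
Qed.

(** The p/2-variation of RZ is at most that of D0 E ^ 2 + K, and K, being
    monotone with total growth at most D0, has p/2-variation at most
    D0 ^ (p / 2). Since D0 is a small multiple of N, V is less than itself. *)
Lemma excursion_absurd : False.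
Proof.
have D00 : 0 < D0.
  have : 0 < excursion_const.
    rewrite /excursion_const -/s ltr_wpDl//.
      apply: mulr_ge0 => //; apply: mulr_ge0 s0 _.
      by apply: mulr_ge0 (exprn_ge0 _ DM0); exact: ler0n.
    have D1 : 1 <= d%:R * M :> R.
      by apply: mulr_ege1 => //; rewrite ler1n.
    by rewrite mulr_gt0// exprn_gt0// (lt_le_trans _ D1).
  by move=> C0; rewrite /D0 !mulr_gt0.
pose W2 u v := W u v + D0^-1 * (K v - K u).
have W2C : control a b W2.
  apply: controlD => //; apply: controlZ; first by rewrite invr_ge0 ltW.
  split; first by move=> u v au uv vb; rewrite subr_ge0 HK.
  by move=> u m v _ _ _ _; rewrite le_eqVlt; apply/orP; left; apply/eqP; ring.
have p21 : 1 <= p / 2 by have := p2; lra.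
have RZp : forall u v, a <= u -> u < v -> v <= b ->
    `|RZ u v| `^ (p / 2) <= 4 * D0 `^ (p / 2) * W2 u v.
  move=> u v au /ltW uv vb.
  have k0' : 0 <= K v - K u by rewrite subr_ge0 HK.
  have DE : 0 <= D0 * E u v ^+ 2 by rewrite mulr_ge0 ?exprn_ge0// ltW.
  apply: (@le_trans _ _ ((D0 * E u v ^+ 2 + (K v - K u)) `^ (p / 2))).
    apply: (ge0_ler_powR (ltW p20)); rewrite ?nnegrE//; last exact: RZ_le.
    exact: addr_ge0 DE k0'.
  apply: le_trans (powR_add_le DE k0' (ltW p20)) _.
  have two : 2 `^ (p / 2) <= 4 :> R.
    apply: (@le_trans _ _ (2 `^ 2%:R)).
      by rewrite ler_powR ?ler1n//; have := p3; lra.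
    by rewrite powR_mulrn//; lra.
  have hE : (D0 * E u v ^+ 2) `^ (p / 2) = D0 `^ (p / 2) * W u v.
    rewrite powRM ?exprn_ge0 ?(ltW D00)// E2W// powRK//; exact: W0.
  have hK : (K v - K u) `^ (p / 2) <= D0 `^ (p / 2) * (D0^-1 * (K v - K u)).
    set x := D0^-1 * (K v - K u).
    have xE : K v - K u = D0 * x by rewrite /x mulVKf ?gt_eqF.
    have x0 : 0 <= x by rewrite mulr_ge0// invr_ge0 ltW.
    have x1 : x <= 1.
      rewrite /x mulrC ler_pdivrMr// mul1r.
      have := HK (lexx a) au (le_trans uv vb); have := HK (le_trans au uv) vb (lexx b).
      by move: Kab; lra.
    rewrite xE powRM ?(ltW D00)// ler_wpM2l ?powR_ge0//.
    move: x0; rewrite le_eqVlt => /predU1P[<-|x0].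
      by rewrite powR0// gt_eqF.
    by rewrite ge1r_powR// x0.
  have h0 : 0 <= (D0 * E u v ^+ 2) `^ (p / 2) + (K v - K u) `^ (p / 2).
    by rewrite addr_ge0 ?powR_ge0.
  apply: le_trans (ler_wpM2r h0 two) _.
  rewrite -mulrA ler_wpM2l// /W2 mulrDr hE.
  by rewrite lerD2l.
have VD : V <= 12 * D0 `^ (p / 2).
  rewrite /V /pvar; apply: ge_sup.
    by have [] := finvar_has_sup ab HRZ.
  move=> _ [P abP <-].
  apply: le_trans (ler_psum abP RZp) _; rewrite psumZ.
  have Dp : 0 <= D0 `^ (p / 2) by exact: powR_ge0.
  have -> : 12 * D0 `^ (p / 2) = 4 * D0 `^ (p / 2) * 3 by ring.
  rewrite ler_wpM2l ?mulr_ge0//.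
  apply: le_trans (psum_control W2C (lexx _) (lexx _) abP) _.
  rewrite /W2; have : D0^-1 * (K b - K a) <= 1.
    by rewrite mulrC ler_pdivrMr// mul1r.
  by move: Wab; lra.
have C0 := excursion_const_ge0 M0.
have Ck : 0 <= excursion_const * kappa by rewrite mulr_ge0// ltW.
have : D0 `^ (p / 2) <= 1 / 13 * V.
  rewrite /D0 powRM ?(ltW N0)// NV ler_wpM2r ?(ltW V0)//.
  apply: (@le_trans _ _ ((1 / 13) `^ (p / 2))).
    by rewrite ge0_ler_powR ?nnegrE ?(ltW p20)//; have := kC; lra.
  by apply: ge1r_powR => //; lra.
by move: VD V0; lra.
Qed.

End Positive.

(** On an interval where the data are small and only the lower path Y2 is
    reflected, paths that start together and end with Y2 b <= Y1 b coincide. *)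
Lemma excursion_vanishes u : a <= u -> u <= b -> Y1 u = Y2 u.
Proof.
apply: excursion_null; apply/eqP; rewrite eq_le.
have V0 : 0 <= V by exact: pv.1.
by rewrite V0 andbT leNgt; apply/negP => /excursion_absurd.
Qed.

End Excursion.

(** * Flatness of the reflection term off the barrier *)

Section Flatness.
Context {R : realType}.

(** The integral of a nonnegative function is a supremum over the simple
    functions below it, hence monotone whether or not the functions are
    measurable. *)
Lemma ge0_le_integral_pointwise d (U : measurableType d)
    (mu : {measure set U -> \bar R}) (D : set U) (f1 f2 : U -> \bar R) :
  (forall x, D x -> (0 <= f1 x)%E) -> (forall x, D x -> (f1 x <= f2 x)%E) ->
  (\int[mu]_(x in D) f1 x <= \int[mu]_(x in D) f2 x)%E.
Proof.
move=> f0 f12; rewrite !ge0_integralE//; last first.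
  by move=> x Dx; exact: le_trans (f0 x Dx) (f12 x Dx).
apply: le_ereal_sup => _ [h hf <-]; exists h => // x.
by apply: le_trans (hf x) _; exact: lee_restrict.
Qed.

Variables (F : cumulative R R) (T : R) (g : R -> R).
Let mu := lebesgue_stieltjes_measure F.

Lemma stieltjes_itv (s t : R) : s <= t -> mu `]s, t]%classic = (F t - F s)%:E.
Proof.
move=> st; rewrite /mu /lebesgue_stieltjes_measure /measure_extension.
by rewrite measurable_mu_extE/=; [exact: wlength_itv_bnd|exact: is_ocitv].
Qed.

Hypothesis g0 : forall s : R, 0 <= s <= T -> 0 <= g s.
Hypothesis g_int0 : (\int[mu]_(s in `]0%R, T]) (g s)%:E = 0)%E.

Lemma stieltjes_null (A : set R) (k : R) : measurable A -> A `<=` `]0, T] ->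
  0 < k -> (forall s, A s -> k <= g s) -> mu A = 0%E.
Proof.
move=> mA AT k0 Ag.
have : (\int[mu]_(s in `]0%R, T]) (k * \1_A s)%:E <= 0)%E.
  rewrite -g_int0; apply: ge0_le_integral_pointwise => s /=.
    by move=> _; rewrite lee_fin mulr_ge0// ltW.
  rewrite in_itv /= => /andP[s0 sT]; rewrite lee_fin indicE.
  case: (boolP (s \in A)) => [/set_mem/Ag|_]; first by rewrite mulr1.
  by rewrite mulr0 g0// (ltW s0).
have kN : (k < 0)%R -> A = set0 by rewrite ltNge (ltW k0).
have mD : measurable (`]0, T]%classic : set (measurableTypeR R)).
  exact: measurable_itv.
have -> := @integralZl_indic _ _ R mu _ mD (fun=> A) k kN mA.
rewrite integral_indic// setIidl// => H; apply/eqP; rewrite eq_le measure_ge0 andbT.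
by move: H; rewrite pmule_rle0 ?lte_fin.
Qed.

(** The point t is an atom of mass zero, being a set on which g >= g t > 0. *)
Lemma stieltjes_flat_left (t e : R) : 0 < t -> t <= T -> 0 < g t -> 0 < e ->
  exists2 d, 0 < d & forall s, s < t -> t - d < s -> F t - F s <= e.
Proof.
move=> t0 tT gt0 e0.
have m0 : mu [set t] = 0%E.
  apply: (@stieltjes_null _ (g t)) => //.
    by move=> s -> /=; rewrite in_itv/= t0.
  by move=> s ->.
pose I n : set R := `]t - n.+1%:R^-1, t]%classic.
have In n : mu (I n) = (F t - F (t - n.+1%:R^-1))%:E.
  by apply: stieltjes_itv; rewrite gerBl.
have cI : mu \o I @ \oo --> mu (\bigcap_n I n).
  apply: nonincreasing_cvg_mu.
  - by change (mu (I 0%N) < +oo)%E; rewrite In ltry.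
  - by move=> n; exact: measurable_itv.
  - by apply: bigcap_measurable => // n _; exact: measurable_itv.
  move=> m n mn; apply/subsetPset => s; rewrite /I /= !in_itv/= => /andP[h ->].
  rewrite andbT (le_lt_trans _ h)// lerB// lef_pV2 ?posrE//.
  by rewrite ler_nat.
rewrite -set1_bigcap_oc m0 in cI.
have := @fine_cvgP R _ \oo _ (mu \o I) 0.
move=> [/(_ cI)[_ /cvgrPdist_le /(_ e e0)[n _ /(_ n (leqnn n)) /= nI]] _].
exists n.+1%:R^-1; first by rewrite invr_gt0.
move=> s st ts.
move: nI; rewrite In /= sub0r normrN => /(le_trans (ler_norm _)).
by apply: le_trans; rewrite lerD2l lerN2 cumulative_is_nondecreasing// ltW.
Qed.

Hypothesis g_rc : forall t : R, 0 <= t < T -> g s @[s --> t^'+] --> g t.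

Lemma stieltjes_flat_right (t : R) : 0 < t -> t < T -> 0 < g t ->
  exists2 c, t < c <= T & F c = F t.
Proof.
move=> t0 tT gt0; have tT' : 0 <= t < T by rewrite ltW.
have g2 : 0 < g t / 2 by rewrite divr_gt0.
have /cvgrPdist_le /(_ _ g2)[d /= d0 dg] := g_rc tT'.
pose c := Num.min (t + d / 2) T.
have tc : t < c by rewrite /c lt_min tT andbT; lra.
have cT : c <= T by rewrite /c ge_min lexx orbT.
have cd : c < t + d by rewrite /c gt_min; apply/orP; left; lra.
exists c; first by rewrite tc.
have : mu `]t, c]%classic = 0%E.
  apply: (@stieltjes_null _ (g t / 2)) => //.
    move=> s /=; rewrite !in_itv/= => /andP[ts sc].
    by rewrite (lt_trans t0)// (le_trans sc).
  move=> s /=; rewrite in_itv/= => /andP[ts sc].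
  have : `|g t - g s| <= g t / 2.
    apply: dg => //; rewrite /ball_/= distrC gtr0_norm ?subr_gt0//.
    by rewrite ltrBlDl (le_lt_trans sc).
  by move/ler_normlP => [_]; lra.
rewrite stieltjes_itv ?(ltW tc)// => -[] /eqP.
by rewrite subr_eq0 => /eqP.
Qed.

(** The infimum of g on ]a, b] may be zero, because of left limits, so flatness
    is propagated from c > a by considering the supremum of the times up to
    which F = F c: it is attained by [stieltjes_flat_left] and cannot be less
    than b by [stieltjes_flat_right]. *)
Lemma stieltjes_flat (a b : R) : 0 <= a -> a < b -> b <= T ->
  (forall s, a < s -> s <= b -> 0 < g s) -> F b = F a.
Proof.
move=> a0 ab bT gpos.
have Fnd := cumulative_is_nondecreasing F.
have flat c : a < c -> c <= b -> F b = F c.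
  move=> ac cb; pose S := [set s | c <= s <= b /\ F s = F c].
  have Sc : S c by split; rewrite ?lexx.
  have Sb : ubound S b by move=> s [/andP[]].
  have Ssup : has_sup S by split; [exists c|exists b].
  pose m := sup S.
  have cm : c <= m by apply: ub_le_sup Sc; exists b.
  have mb : m <= b by apply: ge_sup => //; exists c.
  have am : a < m := lt_le_trans ac cm.
  have m0 : 0 < m := le_lt_trans a0 am.
  have mT : m <= T := le_trans mb bT.
  have Fm : F m = F c.
    apply/eqP; rewrite eq_le (Fnd _ _ cm) andbT.
    apply/ler_addgt0Pr => e e0.
    have [d d0 dF] := stieltjes_flat_left m0 mT (gpos _ am mb) e0.
    have [s [/andP[cs sb] Fs] ms] := sup_adherent d0 Ssup.
    have sm : s <= m by apply: ub_le_sup; [exists b|split; rewrite ?cs].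
    move: sm; rewrite le_eqVlt => /predU1P[<-|sm]; first by rewrite Fs lerDl ltW.
    by have := dF s sm ms; rewrite Fs lerBlDl.
  move: (mb); rewrite le_eqVlt => /predU1P[<-//|mltb].
  have [c' /andP[mc' c'T] Fc'] := stieltjes_flat_right m0 (lt_le_trans mltb bT)
    (gpos _ am mb).
  pose x := Num.min c' b.
  have mx : m < x by rewrite lt_min mc'.
  have : x <= m.
    apply: ub_le_sup; first by exists b.
    split; first by rewrite (le_trans cm (ltW mx))/= ge_min lexx orbT.
    apply/eqP; rewrite eq_le; apply/andP; split.
      by rewrite -Fm -Fc' Fnd// ge_min lexx.
    by rewrite -Fm Fnd// ltW.
  by rewrite leNgt mx.
apply/eqP; rewrite eq_le (Fnd _ _ (ltW ab)) andbT.
apply/ler_addgt0Pr => e e0.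
have [d Fd] := nondecreasing_right_continuousP a F e0.
pose c := Num.min (a + d%:num) b.
have ac : a < c by rewrite lt_min ab andbT ltrDl gt0.
rewrite (flat c ac) ?ge_min ?lexx ?orbT//.
by apply: le_trans Fd; rewrite Fnd// ge_min lexx.
Qed.

End Flatness.

(** * Uniqueness *)

Section RightSmall.
Context {R : realType}.
Implicit Types (w : R -> R -> R) (T : R).

(** Nothing of the kind can hold on intervals ending at t, where the data may
    jump. *)
Definition right_small T w : Prop := forall t e : R, 0 <= t -> t < T -> 0 < e ->
  exists2 c, t < c <= T & w t c <= e.

Lemma right_smallD T w1 w2 : control 0 T w1 -> control 0 T w2 ->
  right_small T w1 -> right_small T w2 ->
  right_small T (fun u v => w1 u v + w2 u v).
Proof.
move=> C1 C2 s1 s2 t e t0 tT e0; have e2 : 0 < e / 2 by rewrite divr_gt0.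
have [c1 /andP[tc1 c1T] h1] := s1 t _ t0 tT e2.
have [c2 /andP[tc2 c2T] h2] := s2 t _ t0 tT e2.
pose c := Num.min c1 c2.
have tc : t < c by rewrite lt_min tc1.
have cc1 : c <= c1 by rewrite ge_min lexx.
have cc2 : c <= c2 by rewrite ge_min lexx orbT.
exists c; first by rewrite tc (le_trans cc1).
have := control_le C1 t0 (lexx t) (ltW tc) cc1 c1T.
have := control_le C2 t0 (lexx t) (ltW tc) cc2 c2T.
lra.
Qed.

Lemma pvar_right_small {E : normedModType R} T r (Xi : R -> R -> E) : 0 < r ->
  finvar r 0 T Xi ->
  (forall t, 0 <= t < T -> Xi t v @[v --> t^'+] --> (0 : E)) ->
  right_small T (pvar r Xi).
Proof.
move=> r0 fv Xi0 t e t0 tT e0; apply: pvar_right0 => //.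
  exact: finvar_sub t0 (ltW tT) (lexx _) fv.
by apply: Xi0; rewrite t0.
Qed.

Lemma eq_finvar {E : normedModType R} r a b (Xi Xi' : R -> R -> E) :
  (forall u v, a <= u -> u < v -> v <= b -> Xi u v = Xi' u v) ->
  finvar r a b Xi -> finvar r a b Xi'.
Proof.
move=> XiE [B HB]; exists B => P abP; apply: le_trans (HB P abP).
by apply: ler_psum abP _ => u v au uv vb; rewrite XiE.
Qed.

Lemma incr_right_cvg {E : normedModType R} (Z : R -> E) t :
  Z s @[s --> t^'+] --> Z t -> incr Z t v @[v --> t^'+] --> (0 : E).
Proof.
move=> H; rewrite /incr -(subrr (Z t)).
by apply: cvgB => //; exact: cvg_cst.
Qed.

End RightSmall.

Section Uniqueness.
Context {R : realType} {d : nat}.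
Variables (T p M : R) (X : R -> 'cV[R]_d) (XX : R -> R -> 'M[R]_d).
Variables (L : R -> R) (f : R -> 'rV[R]_d) (y : R).
Hypotheses (d1 : (1 <= d)%N) (T0 : 0 < T) (p2 : 2 <= p) (p3 : p < 3).
Hypothesis fM : smooth_field f M.
Hypothesis chen : forall s u t : R, 0 <= s -> s <= u -> u <= t -> t <= T ->
  XX s t - XX s u - XX u t = incr X s u *m (incr X u t)^T.

(** All that the comparison uses of a solution with Y' = f(Y). *)
Record solution_facts (Y K : R -> R) : Prop := SolutionFacts {
  sol_int : forall t, 0 <= t <= T ->
    psum 0 P (germ X XX f Y) @[P --> mesh_to0 0 t] --> Y t - y - K t;
  sol_barrier : forall t, 0 <= t <= T -> L t <= Y t;
  sol_mono : forall s t, 0 <= s -> s <= t -> t <= T -> K s <= K t;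
  sol_start : K 0 = 0;
  sol_flat_left : forall t e, 0 < t -> t <= T -> L t < Y t -> 0 < e ->
    exists2 dl, 0 < dl & forall s, 0 <= s -> s < t -> t - dl < s -> K t - K s <= e;
  sol_flat : forall a b, 0 <= a -> a < b -> b <= T ->
    (forall s, a < s -> s <= b -> L s < Y s) -> K b = K a;
  sol_var : finvar p 0 T (incr Y);
  sol_rem_var : finvar (p / 2) 0 T (remainder X f Y);
  sol_right : forall t, 0 <= t < T -> incr Y t v @[v --> t^'+] --> (0 : R);
  sol_rem_right : forall t, 0 <= t < T ->
    remainder X f Y t v @[v --> t^'+] --> (0 : R) }.

Section Pair.
Variables (Y1 K1 Y2 K2 : R -> R).
Hypotheses (S1 : solution_facts Y1 K1) (S2 : solution_facts Y2 K2).

Let Xi u v := germ X XX f Y1 u v - germ X XX f Y2 u v.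
Let J t := (Y1 t - y - K1 t) - (Y2 t - y - K2 t).

Lemma diff_germ_int t : 0 <= t <= T -> psum 0 P Xi @[P --> mesh_to0 0 t] --> J t.
Proof.
move=> tT.
have -> : (fun P => psum 0 P Xi) = (fun P => psum 0 P (germ X XX f Y1)) -
    (fun P => psum 0 P (germ X XX f Y2)).
  by apply/funext => P; rewrite psumB.
exact: cvgB (sol_int S1 tT) (sol_int S2 tT).
Qed.

(** For s close to t with Z_s <= 0, the increment of Z up to t is at most
    |Z_s| / 2 from the germ, plus small errors from the integral and from K1,
    which does not jump at t since Y1 t > Y2 t >= L t; K2 only lowers it. So
    Z_t would be at most half of itself. *)
Lemma no_upward_crossing t : 0 < t -> t <= T -> Y2 t < Y1 t ->
  (exists2 dl, 0 < dl & forall s, 0 <= s -> s < t -> t - dl < s ->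
     `|Xi s t| <= `|Y1 s - Y2 s| / 2) ->
  (forall dl, 0 < dl -> exists s, [/\ 0 <= s, s < t, t - dl < s & Y1 s <= Y2 s]) ->
  False.
Proof.
move=> t0 tT Yt [d0 d00 Hd0] near_t.
have tT' : 0 <= t <= T by rewrite ltW.
pose e := (Y1 t - Y2 t) / 4.
have e0 : 0 < e by rewrite divr_gt0// subr_gt0.
have [da da0 Ha] := germ_jump diff_germ_int tT' e0.
have [db db0 Hb] := sol_flat_left S1 t0 tT (le_lt_trans (sol_barrier S2 tT') Yt) e0.
pose dl := Num.min d0 (Num.min da db).
have dl0 : 0 < dl by rewrite !lt_min d00 da0.
have [s [s0 st sdl Ys]] := near_t dl dl0.
have h0 : t - d0 < s by apply: le_lt_trans sdl; rewrite lerD2l lerN2 ge_min lexx.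
have ha : t - da < s.
  by apply: le_lt_trans sdl; rewrite lerD2l lerN2 !ge_min lexx orbT.
have hb : t - db < s.
  by apply: le_lt_trans sdl; rewrite lerD2l lerN2 !ge_min lexx !orbT.
have i1 := Hd0 s s0 st h0.
have /ler_normlP[_ i2] := Ha s s0 st ha.
have i3 := Hb s s0 st hb.
have i4 := sol_mono S2 s0 (ltW st) tT.
have i5 : `|Y1 s - Y2 s| = Y2 s - Y1 s by rewrite ler0_norm ?opprB// subr_le0.
have /ler_normlP[_ i6] := i1.
move: (Xi s t) i2 i6 => x; rewrite i5 /J => i2 i6.
have eE : Y1 t - Y2 t = 4 * e by rewrite /e; field.
by move: e i2 i3 e0 eE {Ha Hb} => e i2 i3 e0 eE; lra.
Qed.

Section Local.
Variables (tau beta kappa : R) (omega : R -> R -> R).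
Hypotheses (tau0 : 0 <= tau) (bT : beta <= T).
Hypotheses (k0 : 0 < kappa) (k1 : kappa <= 1).
Hypothesis kC : @excursion_const R d M p * kappa <= 1 / 13.
Hypothesis omegaC : control tau beta omega.
Hypothesis omegak : omega tau beta <= kappa `^ p.
Let on (H : R -> R -> Prop) :=
  forall u v, tau <= u -> u <= v -> v <= beta -> H u v.
Hypothesis HX : on (fun u v => `|incr X u v| `^ p <= omega u v).
Hypothesis HXX : on (fun u v => `|XX u v| `^ (p / 2) <= omega u v).
Hypothesis HY1 : on (fun u v => `|incr Y1 u v| `^ p <= omega u v).
Hypothesis HY2 : on (fun u v => `|incr Y2 u v| `^ p <= omega u v).
Hypothesis HR2 : on (fun u v => `|remainder X f Y2 u v| `^ (p / 2) <= omega u v).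

Let M1 : 1 <= M. Proof. by case: fM. Qed.
Let p0 : 0 < p. Proof. by have := p2; lra. Qed.
Let p20 : 0 < p / 2. Proof. by rewrite divr_gt0. Qed.

Let omega_le u v : tau <= u -> u <= v -> v <= beta -> omega u v <= kappa `^ p.
Proof.
move=> au uv vb; apply: le_trans omegak.
exact: (control_le omegaC (lexx _) au uv vb (lexx _)).
Qed.

Lemma Xi_half u v : tau <= u -> u <= v -> v <= beta ->
  `|Xi u v| <= `|Y1 u - Y2 u| / 2.
Proof.
move=> au uv vb; have w := omega_le au uv vb.
have hX : `|incr X u v| <= kappa.
  have := powR_root_le p0 (normr_ge0 (incr X u v)) (ltW k0) ler01.
  rewrite powR1 !mulr1; apply; exact: le_trans (HX au uv vb) w.
have hXX : `|XX u v| <= kappa.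
  have := powR_root_le p20 (normr_ge0 (XX u v)) (exprn_ge0 2 (ltW k0)) ler01.
  rewrite powR1 !mulr1 => h; apply: (@le_trans _ _ (kappa ^+ 2)).
    apply: h; apply: le_trans (HXX au uv vb) _; apply: le_trans w _.
    by rewrite -powR_mulrn ?(ltW k0)// -powRrM (_ : 2%:R * (p / 2) = p)//; field.
  by rewrite expr2 ler_piMl// ltW.
set z := `|Y1 u - Y2 u|.
have z0 : 0 <= z by exact: normr_ge0.
have D0 : 0 <= d%:R :> R by exact: ler0n.
have M0 : 0 <= M := le_trans ler01 M1.
have l1 : `|linform (f (Y1 u) - f (Y2 u)) (incr X u v)| <= d%:R * M * z * kappa.
  apply: le_trans (linform_le _ (fun j => field_lip fM _ _ j)) _.
  by rewrite mulrA ler_wpM2l// !mulr_ge0.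
have l2 : `|bilform (coef f (Y1 u) - coef f (Y2 u)) (XX u v)| <=
    2 * (d%:R * M) ^+ 2 * z * kappa.
  apply: le_trans (coef_norm_lip fM _ (lexx z)) _.
  have -> : 2 * (d%:R * M) ^+ 2 * z * kappa =
    d%:R ^+ 2 * (2 * M ^+ 2 * z) * kappa by ring.
  by rewrite ler_wpM2l// !mulr_ge0 ?exprn_ge0.
rewrite linformB in l1; rewrite bilformB in l2.
have regroup (a a' b b' B B' : R) : `|a - a'| <= B -> `|b - b'| <= B' ->
    `|(a + b) - (a' + b')| <= B + B'.
  move=> h h'; rewrite opprD addrACA.
  by apply: le_trans (ler_normD _ _) (lerD h h').
apply: le_trans (regroup _ _ _ _ _ _ l1 l2) _.
have s0 : 0 <= sewing_const (3 / p).
  by apply: sewing_const_ge0; rewrite ltr_pdivlMr// mul1r.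
have DM1 : 1 <= d%:R * M by apply: mulr_ege1 => //; rewrite ler1n.
have DM0 : 0 <= d%:R * M := le_trans ler01 DM1.
have q1 : 8 * ((d%:R * M) ^+ 2 * kappa) <= 1 / 13.
  apply: le_trans kC; rewrite mulrA ler_wpM2r ?(ltW k0)// /excursion_const.
  rewrite lerDr; apply: mulr_ge0 => //.
  apply: mulr_ge0 s0 _; apply: mulr_ge0 (exprn_ge0 _ DM0); exact: ler0n.
have q2 : d%:R * M * kappa <= (d%:R * M) ^+ 2 * kappa.
  by rewrite ler_wpM2r ?(ltW k0)// expr2 ler_peMl.
have q3 : d%:R * M * kappa + 2 * ((d%:R * M) ^+ 2 * kappa) <= 1 / 2 by lra.
have -> : d%:R * M * z * kappa + 2 * (d%:R * M) ^+ 2 * z * kappa =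
  (d%:R * M * kappa + 2 * ((d%:R * M) ^+ 2 * kappa)) * z by ring.
by rewrite [leRHS]mulrC -[X in _ <= X * z]div1r ler_wpM2r.
Qed.

(** If Z_t > 0, let a be the last time before t at which Z <= 0. It is attained
    by [no_upward_crossing], Z_a = 0 by right-continuity, and K1 is constant on
    [a, t]; so [excursion_vanishes] applies. *)
Lemma local_comparison t : Y1 tau = Y2 tau -> tau <= t -> t <= beta ->
  Y1 t <= Y2 t.
Proof.
move=> Ytau taut tbeta; rewrite leNgt; apply/negP => Yt.
pose S := [set s | tau <= s <= t /\ Y1 s <= Y2 s].
have Stau : S tau by split; rewrite ?lexx// Ytau.
have ubS : ubound S t by move=> s [/andP[]].
have supS : has_sup S by split; [exists tau|exists t].
pose a := sup S.
have taua : tau <= a by apply: ub_le_sup Stau; exists t.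
have at_ : a <= t by apply: ge_sup => //; exists tau.
have a0 : 0 <= a := le_trans tau0 taua.
have tT : t <= T := le_trans tbeta bT.
have aT : a <= T := le_trans at_ tT.
have above s : a < s -> s <= t -> Y2 s < Y1 s.
  move=> as_ st; rewrite ltNge; apply/negP => Ys.
  have : s <= a.
    apply: ub_le_sup; first by exists t.
    by split; rewrite // st (le_trans taua)// ltW.
  by rewrite leNgt as_.
have Ya1 : Y1 a <= Y2 a.
  rewrite leNgt; apply/negP => Ya.
  have taua' : tau < a.
    rewrite lt_neqAle taua andbT; apply/eqP => E.
    by move: Ya; rewrite -E Ytau ltxx.
  apply: (no_upward_crossing (le_lt_trans tau0 taua') aT Ya).
    exists (a - tau); first by rewrite subr_gt0.
    move=> s s0 sa; rewrite opprB addrCA subrr addr0 => taus.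
    by apply: Xi_half (ltW taus) (ltW sa) _; exact: le_trans tbeta.
  move=> dl dl0; have [s [/andP[taus st] Ys] ads] := sup_adherent dl0 supS.
  have sa : s <= a by apply: ub_le_sup; [exists t|split; rewrite ?taus].
  exists s; split=> //; first exact: le_trans taus.
  rewrite lt_neqAle sa andbT; apply/eqP => E.
  by move: Ys; rewrite E leNgt Ya.
have alt : a < t.
  rewrite lt_neqAle at_ andbT; apply/eqP => E.
  by move: Ya1; rewrite E leNgt Yt.
have Ya : Y1 a = Y2 a.
  apply/eqP; rewrite eq_le Ya1 /= leNgt; apply/negP => Ya.
  have aT' : 0 <= a < T by rewrite a0 (lt_le_trans alt).
  pose e := (Y2 a - Y1 a) / 3.
  have e0 : 0 < e by rewrite divr_gt0// subr_gt0.
  have /cvgrPdist_le /(_ e e0) h1 := sol_right S1 aT'.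
  have /cvgrPdist_le /(_ e e0) h2 := sol_right S2 aT'.
  have h3 : \forall v \near a^'+, a < v by exact: nbhs_right_gt.
  have h4 : \forall v \near a^'+, v <= t by exact: nbhs_right_le.
  have [v [[i1 i2] [i3 i4]]] :=
    @filter_ex _ _ (at_right_proper_filter a) _
      (filterI (filterI h1 h2) (filterI h3 h4)).
  have := above v i3 i4; move: i1 i2; rewrite !sub0r !normrN /incr.
  by move=> /ler_normlP[_ i1] /ler_normlP[i2 _]; rewrite /e in i1 i2; lra.
have K1E u : a <= u -> u <= t -> K1 u = K1 a.
  rewrite le_eqVlt => /predU1P[->//|au] ut.
  apply: (sol_flat S1) => //; first exact: le_trans tT.
  move=> s as_ su; apply: le_lt_trans (above _ as_ (le_trans su ut)).
  apply: (sol_barrier S2).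
  by rewrite (le_trans a0 (ltW as_)) (le_trans su)// (le_trans ut).
have fR : finvar (p / 2) a t (fun u v => remainder X f Y1 u v - remainder X f Y2 u v).
  apply: finvar_sub a0 at_ tT _.
  by apply: finvarB => //; [exact: (sol_rem_var S1)|exact: (sol_rem_var S2)].
suff : Y1 t = Y2 t by move=> E; move: Yt; rewrite E ltxx.
have sub (H : R -> R -> Prop) : on H -> forall u v, a <= u -> u <= v -> v <= t ->
    H u v.
  by move=> HH u v au uv vt; apply: HH uv _; [exact: le_trans au|exact: le_trans tbeta].
apply: (@excursion_vanishes R d X XX f M p p2 p3 d1 fM a t kappa omega
  Y1 Y2 J K2 at_ k0 k1 kC) => //.
- exact: control_sub taua tbeta omegaC.
- exact: omega_le.
- exact: sub HX.
- exact: sub HXX.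
- exact: sub HY1.
- exact: sub HY2.
- exact: sub HR2.
- move=> u m v au um mv vt; apply: chen => //; first exact: le_trans au.
  exact: le_trans tT.
- move=> u v au uv vt x B HB; apply: (germ_bound diff_germ_int) => //.
    exact: le_trans au.
  exact: le_trans tT.
- move=> u v au uv vt; apply: (sol_mono S2) => //; first exact: le_trans au.
  exact: le_trans tT.
- move=> u v au uv vt; rewrite /J (K1E u au (le_trans uv vt)).
  by rewrite (K1E v (le_trans au uv) vt); ring.
- exact: ltW.
Qed.

End Local.
(** At t = 0 both paths start from y; for t > 0 a positive Z_t would be an
    upward crossing with equal germs. *)
Lemma agreement_extends t : 0 <= t <= T ->
  (forall s, 0 <= s -> s < t -> Y1 s = Y2 s) -> Y1 t <= Y2 t.
Proof.
move=> /andP[t0 tT] eqY; rewrite leNgt; apply/negP => Yt.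
move: (t0); rewrite le_eqVlt => /predU1P[tE|tpos].
  have z : (0 : R) <= 0 <= T by apply/andP; split=> //; exact: ltW.
  have := germ0 (sol_int S1 z); have := germ0 (sol_int S2 z).
  rewrite (sol_start S1) (sol_start S2) tE.
  by move: Yt; lra.
apply: (no_upward_crossing tpos tT Yt).
  exists 1 => // s s0 st _.
  by rewrite /Xi /germ eqY// subrr normr0 divr_ge0.
move=> dl dl0; pose s := Num.max 0 (t - dl / 2).
have st : s < t by rewrite gt_max tpos /=; lra.
have s0 : 0 <= s by rewrite le_max lexx.
exists s; split=> //; last by rewrite eqY.
by rewrite lt_max; apply/orP; right; lra.
Qed.

End Pair.

Hypothesis X_var : finvar p 0 T (incr X).
Hypothesis XX_var : finvar (p / 2) 0 T XX.
Hypothesis X_right :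
  forall t, 0 <= t < T -> incr X t v @[v --> t^'+] --> (0 : 'cV[R]_d).
Hypothesis XX_right :
  forall t, 0 <= t < T -> XX t v @[v --> t^'+] --> (0 : 'M[R]_d).

Lemma solutions_agree Y1 K1 Y2 K2 : solution_facts Y1 K1 ->
  solution_facts Y2 K2 -> forall t, 0 <= t <= T -> Y1 t = Y2 t.
Proof.
move=> S1 S2.
have p0 : 0 < p by have := p2; lra.
have p20 : 0 < p / 2 by rewrite divr_gt0.
have ext t : 0 <= t <= T -> (forall s, 0 <= s -> s < t -> Y1 s = Y2 s) ->
    Y1 t = Y2 t.
  move=> tT eqY; apply/eqP; rewrite eq_le (agreement_extends S1 S2 tT eqY).
  by apply: (agreement_extends S2 S1 tT) => s s0 st; rewrite eqY.
have XX0 s : 0 <= s -> s <= T -> XX s s = 0.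
  by move=> s0 sT; apply: chen_diag (chen s0 (lexx s) (lexx s) sT).
pose vX := pvar p (incr X); pose vXX := pvar (p / 2) XX.
pose v1 := pvar p (incr Y1); pose v2 := pvar p (incr Y2).
pose r1 := pvar (p / 2) (remainder X f Y1).
pose r2 := pvar (p / 2) (remainder X f Y2).
have cX : control 0 T vX := pvar_control X_var.
have cXX : control 0 T vXX := pvar_control XX_var.
have c1 : control 0 T v1 := pvar_control (sol_var S1).
have c2 : control 0 T v2 := pvar_control (sol_var S2).
have k1 : control 0 T r1 := pvar_control (sol_rem_var S1).
have k2 : control 0 T r2 := pvar_control (sol_rem_var S2).
have sX : right_small T vX := pvar_right_small p0 X_var X_right.
have sXX : right_small T vXX := pvar_right_small p20 XX_var XX_right.
have s1 : right_small T v1 := pvar_right_small p0 (sol_var S1) (sol_right S1).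
have s2 : right_small T v2 := pvar_right_small p0 (sol_var S2) (sol_right S2).
have q1 : right_small T r1 :=
  pvar_right_small p20 (sol_rem_var S1) (sol_rem_right S1).
have q2 : right_small T r2 :=
  pvar_right_small p20 (sol_rem_var S2) (sol_rem_right S2).
(* w is a control for both solutions, so that it serves for both comparisons *)
pose w u v := (vX u v + vXX u v) + ((v1 u v + v2 u v) + (r1 u v + r2 u v)).
have cw : control 0 T w by do ?apply: controlD.
have sw : right_small T w.
  by do ?apply: right_smallD => //; do ?apply: controlD.
apply: contrapT => /existsNP[t /not_implyP[tT Yt]].
pose S := [set s | 0 <= s <= T /\ Y1 s <> Y2 s].
have lbS : lbound S 0 by move=> s [/andP[]].
have infS : has_inf S by split; [exists t|exists 0].
pose tau := inf S.
have tau0 : 0 <= tau by apply: lb_le_inf lbS; exists t.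
have tauT : tau <= T.
  have [t0 tT'] := andP tT.
  by apply: le_trans tT'; apply: ge_inf => //; exists 0.
have before s : 0 <= s -> s < tau -> Y1 s = Y2 s.
  move=> s0 stau; apply: contrapT => Ys.
  have : tau <= s.
    apply: ge_inf; first by exists 0.
    by split=> //; rewrite s0 (le_trans (ltW stau)).
  by rewrite leNgt stau.
have Ytau : Y1 tau = Y2 tau by apply: ext before; rewrite tau0.
have tauT' : tau < T.
  rewrite lt_neqAle tauT andbT; apply/eqP => E; apply: Yt.
  have [t0 tT'] := andP tT.
  have := tT'; rewrite le_eqVlt => /predU1P[->|tltT]; first by rewrite -E.
  by apply: before => //; rewrite E.
pose C : R := @excursion_const R d M p.
have M1 : 1 <= M by case: fM.
have C0 : 0 <= C by apply: excursion_const_ge0 => //; exact: le_trans M1.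
pose kappa := (13 * (C + 1))^-1.
have kpos : 0 < 13 * (C + 1) by lra.
have k0 : 0 < kappa by rewrite invr_gt0.
have kle1 : kappa <= 1 by rewrite invf_le1//; lra.
have kC : C * kappa <= 1 / 13.
  by rewrite /kappa ler_pdivrMr//; lra.
have [beta /andP[tb bT] wb] := sw tau (kappa `^ p) tau0 tauT' (powR_gt0 p k0).
have cwb : control tau beta w := control_sub tau0 bT cw.
have w0 u v : tau <= u -> u <= v -> v <= beta ->
    [/\ vX u v <= w u v, vXX u v <= w u v &
     [/\ v1 u v <= w u v, v2 u v <= w u v, r1 u v <= w u v & r2 u v <= w u v]].
  move=> tu uv vb; have u0 := le_trans tau0 tu; have vT := le_trans vb bT.
  have := cX.1 u v u0 uv vT; have := cXX.1 u v u0 uv vT.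
  have := c1.1 u v u0 uv vT; have := c2.1 u v u0 uv vT.
  have := k1.1 u v u0 uv vT; have := k2.1 u v u0 uv vT.
  rewrite /w.
  move: (vX u v) (vXX u v) (v1 u v) (v2 u v) (r1 u v) (r2 u v) => a1 a2 a3 a4 a5 a6.
  by split; [lra|lra|split; lra].
have HX u v : tau <= u -> u <= v -> v <= beta -> `|incr X u v| `^ p <= w u v.
  move=> tu uv vb; have [h _ _] := w0 u v tu uv vb; apply: le_trans h.
  exact: (le_pvar p0 X_var (fun s _ _ => incr_diag X s) (le_trans tau0 tu) uv (le_trans vb bT)).
have HXX u v : tau <= u -> u <= v -> v <= beta -> `|XX u v| `^ (p / 2) <= w u v.
  move=> tu uv vb; have [_ h _] := w0 u v tu uv vb; apply: le_trans h.
  exact: (le_pvar p20 XX_var XX0 (le_trans tau0 tu) uv (le_trans vb bT)).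
have H1 u v : tau <= u -> u <= v -> v <= beta -> `|incr Y1 u v| `^ p <= w u v.
  move=> tu uv vb; have [_ _ [h _ _ _]] := w0 u v tu uv vb; apply: le_trans h.
  exact: (le_pvar p0 (sol_var S1) (fun s _ _ => incr_diag Y1 s) (le_trans tau0 tu) uv (le_trans vb bT)).
have H2 u v : tau <= u -> u <= v -> v <= beta -> `|incr Y2 u v| `^ p <= w u v.
  move=> tu uv vb; have [_ _ [_ h _ _]] := w0 u v tu uv vb; apply: le_trans h.
  exact: (le_pvar p0 (sol_var S2) (fun s _ _ => incr_diag Y2 s) (le_trans tau0 tu) uv (le_trans vb bT)).
have G1 u v : tau <= u -> u <= v -> v <= beta ->
    `|remainder X f Y1 u v| `^ (p / 2) <= w u v.
  move=> tu uv vb; have [_ _ [_ _ h _]] := w0 u v tu uv vb; apply: le_trans h.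
  exact: (le_pvar p20 (sol_rem_var S1) (fun s _ _ => remainder_diag X f Y1 s) (le_trans tau0 tu) uv (le_trans vb bT)).
have G2 u v : tau <= u -> u <= v -> v <= beta ->
    `|remainder X f Y2 u v| `^ (p / 2) <= w u v.
  move=> tu uv vb; have [_ _ [_ _ _ h]] := w0 u v tu uv vb; apply: le_trans h.
  exact: (le_pvar p20 (sol_rem_var S2) (fun s _ _ => remainder_diag X f Y2 s) (le_trans tau0 tu) uv (le_trans vb bT)).
have bt : 0 < beta - tau by rewrite subr_gt0.
have [s [sT Ys] sb] := inf_adherent bt infS.
have taus : tau <= s by apply: ge_inf; [exists 0|split].
apply: Ys; apply/eqP; rewrite eq_le.
have sbeta : s <= beta by move: sb; rewrite -/tau; lra.
rewrite (local_comparison S1 S2 tau0 bT k0 kle1 kC cwb wb HX HXX H1 H2 G2 Ytau taus sbeta).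
exact: (local_comparison S2 S1 tau0 bT k0 kle1 kC cwb wb HX HXX H2 H1 G1 (esym Ytau) taus sbeta).
Qed.

End Uniqueness.

(** * From the definition of a solution *)

Section SolutionFacts.
Context {R : realType} {d : nat}.
Variables (T p : R) (X : R -> 'cV[R]_d) (XX : R -> R -> 'M[R]_d).
Variables (L : R -> R) (f : R -> 'rV[R]_d) (y : R).
Hypotheses (T0 : 0 < T) (p2 : 2 <= p).

Lemma solution_facts_of Y Y' K : Dpath p T L ->
  reflected_solution p T X XX L f y Y Y' K ->
  (forall t, 0 <= t <= T -> Y' t = f (Y t)) ->
  solution_facts T p X XX L f y Y K.
Proof.
move=> [[Lright _] _] [[[YD Y'D RD] [[Kright _] _]] Yeq LY [Kmono K0] [F FK Fint]] Y'E.
have p0 : 0 < p by have := p2; lra.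
have p20 : 0 < p / 2 by rewrite divr_gt0.
have FE s : 0 <= s <= T -> F s = K s.
  by move=> /andP[s0 sT]; rewrite FK /const_ext max_l// min_l.
have g0 (s : R) : 0 <= s <= T -> 0 <= Y s - L s.
  by move=> sT; rewrite subr_ge0 LY.
have TT : 0 <= T <= T by rewrite ltW/=.
have [[Yright _] Yvar] := YD.
have [Rvar _ Rright] := RD.
split=> //.
- move=> t tT; have [I HI YI] := Yeq t tT.
  have -> : Y t - y - K t = I by rewrite YI; ring.
  apply: eq_germ_cvg HI => u v u0 uv vt.
  rewrite /germ /coef Y'E// u0 (le_trans (ltW uv))// (le_trans vt)//.
  by have [] := andP tT.
- move=> t e t0 tT Lt e0.
  have gt0 : 0 < Y t - L t by rewrite subr_gt0.
  have [dl dl0 H] := stieltjes_flat_left g0 (Fint T TT) t0 tT gt0 e0.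
  exists dl => // s s0 st ts; have := H s st ts.
  by rewrite !FE ?s0 ?(ltW t0) ?tT ?(le_trans (ltW st)).
- move=> a b a0 ab bT above.
  rewrite -FE ?(le_trans a0 (ltW ab))// -[RHS]FE ?a0 ?(le_trans (ltW ab))//.
  apply: (stieltjes_flat g0 (Fint T TT) _ a0 ab bT).
    by move=> t tT; apply: cvgB; [exact: Yright|exact: Lright].
  by move=> s as_ sb; rewrite subr_gt0 above.
- exact: rvar_finvar.
- apply: eq_finvar (rvar_finvar p20 Rvar) => u v u0 uv vT.
  by rewrite /remainder Y'E// u0 (le_trans (ltW uv)).
- by move=> t tT; apply: incr_right_cvg; exact: Yright.
- move=> t /andP[t0 tT].
  have tT' : 0 <= t <= T by rewrite t0 ltW.
  have [H _] := Rright t tT'.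
  have := H t; rewrite lexx tT => /(_ isT).
  rewrite Y'E// -/(remainder X f Y t t) remainder_diag.
  by rewrite /remainder.
Qed.

End SolutionFacts.

Theorem theorem4p1 (R : realType) (d : nat) (T p : R)
    (X : R -> 'cV[R]_d) (XX : R -> R -> 'M[R]_d)
    (L : R -> R) (f : R -> 'rV[R]_d) :
  (1 <= d)%N -> 0 < T -> 2 <= p < 3 ->
  rough_path p T X XX -> Dpath p T L -> Cb 3 f ->
  forall y : R, L 0 <= y ->
  forall (Y1 : R -> R) (Y1' : R -> 'rV[R]_d) (K1 : R -> R)
         (Y2 : R -> R) (Y2' : R -> 'rV[R]_d) (K2 : R -> R),
  reflected_solution p T X XX L f y Y1 Y1' K1 ->
  (forall t, 0 <= t <= T -> Y1' t = f (Y1 t)) ->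
  reflected_solution p T X XX L f y Y2 Y2' K2 ->
  (forall t, 0 <= t <= T -> Y2' t = f (Y2 t)) ->
  forall t, 0 <= t <= T -> [/\ Y1 t = Y2 t, Y1' t = Y2' t & K1 t = K2 t].
Proof.
move=> d1 T0 /andP[p2 p3] [[[Xright _] Xvar] [XXvar _ XXright] chen] LD fC y _.
move=> Y1 Y1' K1 Y2 Y2' K2 sol1 E1 sol2 E2.
have p0 : 0 < p := lt_le_trans (ltr0n _ 2) p2.
have p20 : 0 < p / 2 by rewrite divr_gt0.
have [M fM] := smooth_field_Cb3 fC.
have S1 := solution_facts_of T0 p2 LD sol1 E1.
have S2 := solution_facts_of T0 p2 LD sol2 E2.
have XX0 s : 0 <= s -> s <= T -> XX s s = 0.
  by move=> s0 sT; apply: chen_diag (chen s s s s0 (lexx s) (lexx s) sT).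
have X_right t : 0 <= t < T -> incr X t v @[v --> t^'+] --> (0 : 'cV[R]_d).
  by move=> tT; apply: incr_right_cvg; exact: Xright.
have XX_right t : 0 <= t < T -> XX t v @[v --> t^'+] --> (0 : 'M[R]_d).
  move=> /andP[t0 tT]; have tT' : 0 <= t <= T by rewrite t0 ltW.
  have [H _] := XXright t tT'.
  by have := H t; rewrite lexx tT XX0 ?(ltW tT)// => /(_ isT).
have agree := solutions_agree d1 T0 p2 p3 fM chen (rvar_finvar p0 Xvar)
  (rvar_finvar p20 XXvar) X_right XX_right S1 S2.
move=> t tT; split; [exact: agree|by rewrite E1// E2// agree|].
have [t0 tT'] := andP tT.
have I2 : psum 0 P (germ X XX f Y1) @[P --> mesh_to0 0 t] --> Y2 t - y - K2 t.
  apply: eq_germ_cvg (sol_int S2 tT) => u v u0 uv vt.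
  have YE : Y1 u = Y2 u.
    by apply: agree; rewrite u0 (le_trans (ltW uv))// (le_trans vt).
  by rewrite /germ YE.
have := germ_unique t0 (sol_int S1 tT) I2.
by rewrite (agree t tT) => /addrI/oppr_inj.
Qed.
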